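(* Let $\Gamma$ be a group acting on a uniformly locally finite simplicial complex $X$, let $\pi$ be a representation of $\Gamma$ on a Banach space $E$, and let $1\le p<\infty$. Assume that (1) $L_pH^n(X,\Gamma,\pi)=0$, and (2) $L_pH^{n+1}(X,\Gamma,\pi)$ is reduced. Then there exists a constant $\varepsilon=\varepsilon(\Gamma,X,\pi,n,p)>0$ such that for every $\varepsilon$-deformation $\rho$ of $\pi$ we have $L_pH^n(X,\Gamma,\rho)=0$.
   Context: $\Gamma$ is generated by a fixed finite set $S$, and acts on $X$ freely by simplicial automorphisms. A representation of $\Gamma$ on a Banach space $E$ is a homomorphism $\gamma\mapsto\pi_\gamma$ from $\Gamma$ to the group of bounded invertible linear operators on $E$ (no uniform boundedness is assumed). A representation $\rho$ on the same $E$ is an $\varepsilon$-deformation of $\pi$ if $\sup_{s\in S}\|\pi_s-\rho_s\|_{B(E)}\le\varepsilon$. $F\subseteq X$ is a fundamental domain for the action, assumed to be a subcomplex; $F^{(k)}$ denotes its $k$-simplices. For a simplex $\sigma$ of $X$, $g_\sigma\in\Gamma$ denotes the unique element with $g_\sigma^{-1}\sigma\in F$. $C^k_{(p)}(X,\Gamma,E)$ is the space of functions $f$ from $k$-simplices of $X$ to $E$ that are alternating, satisfy $f(\sigma)=f(g_\sigma^{-1}\sigma)$, and have $\|f\|_p=\big(\sum_{\sigma\in F^{(k)}}\|f(\sigma)\|_E^p\big)^{1/p}<\infty$. The codifferential $d^k_\pi:C^k_{(p)}(X,\Gamma,E)\to C^{k+1}_{(p)}(X,\Gamma,E)$, which is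 regarded as a bounded linear operator for these norms, is $$d^k_\pi f(\sigma)=\sum_{i=0}^{k+1}(-1)^i\,\pi_{g_\sigma^{-1}}\pi_{g_{\sigma_i}}f(\sigma_i),$$ where $\sigma_i$ is the face of $\sigma=(v_0,\dots,v_{k+1})$ omitting $v_i$. Then $L_pH^k(X,\Gamma,\pi)=\ker d^k_\pi/\operatorname{im}d^{k-1}_\pi$ (with $d^{-1}_\pi=0$), and $L_pH^k(X,\Gamma,\pi)$ is called reduced if it equals $\ker d^k_\pi/\overline{\operatorname{im}d^{k-1}_\pi}$, i.e. if $\operatorname{im}d^{k-1}_\pi$ is norm closed. *)

(* Defs.v *)
From HB Require Import structures.
From mathcomp Require Import all_boot all_order all_algebra all_fingroup.
From mathcomp Require Import finmap.
From mathcomp Require Import all_classical all_reals all_analysis.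

Set Implicit Arguments.
Unset Strict Implicit.
Unset Printing Implicit Defensive.

Import Order.TTheory GRing.Theory Num.Theory.
Import numFieldNormedType.Exports.

Local Open Scope classical_set_scope.
Local Open Scope ring_scope.

(* Abstract simplicial complexes with vertex set V; simplices are nonempty. *)
Record simplicial_complex (V : choiceType) := SimplicialComplex {
  simplices :> {fset V} -> Prop;
  simplices_neq0 : ~ simplices fset0;
  simplices_vertex : forall v : V, simplices [fset v]%fset;
  simplices_face : forall s t : {fset V},
    simplices s -> (t `<=` s)%fset -> t != fset0 -> simplices t
}.

(* Every vertex belongs to at most N simplices, N independent of the vertex. *)
Definition uniformly_locally_finite (V : choiceType)
    (X : simplicial_complex V) : Prop :=
  exists N : nat, forall v : V,
    exists A : {fset {fset V}},
      (#|` A| <= N)%N /\ forall s, X s -> v \in s -> s \in A.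

Section Action.
Variables (G : groupType) (V : choiceType).

Record simplicial_action (X : simplicial_complex V) := SimplicialAction {
  act :> G -> V -> V;
  act1 : forall v, act 1%g v = v;
  actM : forall g h v, act (g * h)%g v = act g (act h v);
  act_simplicial : forall g (s : {fset V}), X s -> X [fset act g v | v in s]%fset
}.

Variables (X : simplicial_complex V) (a : simplicial_action X).

Definition act_simplex (g : G) (s : {fset V}) : {fset V} :=
  [fset a g v | v in s]%fset.

(* Freeness on the geometric realization: no simplex is mapped to itself, even
   with its vertices permuted, by a nontrivial element. *)
Definition free_action : Prop :=
  forall g s, X s -> act_simplex g s = s -> g = 1%g.

(* F contains exactly one simplex of each orbit, reached in a unique way.
   Closure of F under faces is not imposed: together with uniqueness it would
   force every face of a simplex to have the same group element as the
   simplex. *)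
Definition fundamental_domain (F : set {fset V}) : Prop :=
  (forall s, F s -> X s) /\ forall s, X s -> exists! g, F (act_simplex g^-1%g s).

Definition dom_elt (F : set {fset V}) (s : {fset V}) : G :=
  xget 1%g [set g | F (act_simplex g^-1%g s)].

End Action.

Definition generating (G : groupType) (S : seq G) : Prop :=
  forall H : set G,
    H 1%g -> (forall g h, H g -> H h -> H (g * h)%g) ->
    (forall g, H g -> H g^-1%g) -> (forall s, s \in S -> H s) -> H = setT.

Section Representations.
Variables (R : realType) (G : groupType).

(* Invertibility of rep g follows from rep1 and repM. *)
Record representation (E : completeNormedModType R) := Representation {
  rep :> G -> E -> E;
  rep_linear : forall g (c : R) x y, rep g (c *: x + y) = c *: rep g x + rep g y;
  rep_bounded : forall g, exists M : R, forall x, `|rep g x| <= M * `|x|;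
  rep1 : forall x, rep 1%g x = x;
  repM : forall g h x, rep (g * h)%g x = rep g (rep h x)
}.

Definition opnorm (E : completeNormedModType R) (T : E -> E) : R :=
  sup [set `|T x| | x in [set x : E | `|x| <= 1]].

Definition deformation (S : seq G) (eps : R) (E : completeNormedModType R)
    (pi rho : representation E) : Prop :=
  \big[Num.max/0]_(s <- S) opnorm (fun x => pi s x - rho s x) <= eps.

End Representations.

Section Cohomology.
Variables (R : realType) (G : groupType) (V : choiceType).
Variables (X : simplicial_complex V) (a : simplicial_action G X).
Variables (F : set {fset V}) (p : R).

Definition vertices k (t : k.-tuple V) : {fset V} := [fset v in tval t]%fset.

Definition ordered_simplex k : set (k.+1.-tuple V) :=
  [set t : k.+1.-tuple V | uniq t /\ X (vertices t)].

Definition face k (t : k.+2.-tuple V) (i : 'I_k.+2) : k.+1.-tuple V :=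
  [tuple tnth t (lift i j) | j < k.+1].

Definition act_tuple k (g : G) (t : k.-tuple V) : k.-tuple V :=
  [tuple of map (a g) t].

(* The k-simplices of F, each listed once, with the vertex ordering given by
   the canonical enumeration of its vertex set; on alternating functions the
   norm of the value does not depend on this ordering. *)
Definition dom_simplices k : set (k.+1.-tuple V) :=
  [set t : k.+1.-tuple V | F (vertices t) /\ tval t = enum_fset (vertices t)].

Section Coefficients.
Variable E : completeNormedModType R.

Definition lpnorm k (f : k.+1.-tuple V -> E) : \bar R :=
  ((\esum_(t in @dom_simplices k) ((`|f t| `^ p)%:E)) `^ p^-1)%E.

(* C^k_(p)(X, G, E); functions on ordered k-simplices are extended by 0 to all
   tuples of vertices, so that equality of cochains is Leibniz equality. *)
Definition cochain k : set (k.+1.-tuple V -> E) :=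
  [set f : k.+1.-tuple V -> E | [/\ forall t, ~ ordered_simplex t -> f t = 0,
               forall t (s : 'S_k.+1), ordered_simplex t ->
                 f [tuple tnth t (s i) | i < k.+1] = (-1) ^+ s *: f t,
               forall t, ordered_simplex t ->
                 f t = f (act_tuple (dom_elt a F (vertices t))^-1%g t)
             & (lpnorm f < +oo)%E]].

Variable pi : representation G E.

Definition codiff k (f : k.+1.-tuple V -> E) : k.+2.-tuple V -> E :=
  fun t => if `[< ordered_simplex t >] then
    \sum_(i < k.+2) (-1) ^+ i *:
      pi (dom_elt a F (vertices t))^-1%g
        (pi (dom_elt a F (vertices (face t i))) (f (face t i)))
  else 0.

Definition codiff_bounded k : Prop :=
  exists M : R, forall f, cochain f ->
    cochain (@codiff k f) /\ (lpnorm (codiff f) <= M%:E * lpnorm f)%E.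

Definition cocycles k : set (k.+1.-tuple V -> E) :=
  [set f : k.+1.-tuple V -> E | cochain f /\ codiff f = (fun=> 0)].

Definition coboundaries k : set (k.+1.-tuple V -> E) :=
  match k with
  | 0 => [set fun=> 0]
  | k'.+1 => @codiff k' @` @cochain k'
  end.

Definition lp_closure k (A : set (k.+1.-tuple V -> E)) :
    set (k.+1.-tuple V -> E) :=
  [set f : k.+1.-tuple V -> E | cochain f /\
    forall e : R, 0 < e -> exists2 h, A h & (lpnorm (f \- h)%R < e%:E)%E].

(* ker d^k / im d^(k-1) = 0 *)
Definition cohomology_zero k : Prop := @cocycles k = @coboundaries k.

Definition cohomology_reduced k : Prop :=
  lp_closure (@coboundaries k) = @coboundaries k.

End Coefficients.

(* The codifferentials of all representations of G on Banach spaces are bounded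
   operators between the spaces C^k_(p). When the domain is infinite, uniform
   local finiteness of X alone does not give this. *)
Definition codifferentials_bounded : Prop :=
  forall (E : completeNormedModType R) (pi : representation G E) (k : nat),
    @codiff_bounded E pi k.

End Cohomology.

(* Main.v *)
(** The cochain spaces are Banach spaces and, by the open mapping theorem,
    hypotheses (1) and (2) provide linear bounds on preimages under the two
    codifferentials of [pi] around degree [n].  If [d_rho] is norm-close to
    [d_pi] in degrees [n - 1] and [n], every [rho]-cocycle [z] is, up to an error
    of norm at most [|z| / 2] that is again a [rho]-cocycle, a [rho]-coboundary
    with a primitive of norm [O(|z|)]; iterating gives [z] exactly.

    The norm-closeness has to be uniform although infinitely many group elements
    may occur in [d]: conjugating [diag(pi, rho)] suitably gives the block
    representation [[pi, (rho - pi)/eps], [0, rho]] on [E^2], bounded uniformly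
    in [rho] because [Gamma] is generated by [S].  Its sum over all small
    deformations acts on one Banach space of bounded families, and boundedness
    of the codifferential of that single representation yields
    [|d_rho - d_pi| <= M eps]. *)

Require Import Defs.
From HB Require Import structures.
From mathcomp Require Import all_boot all_order all_algebra all_fingroup.
From mathcomp Require Import finmap.
From mathcomp Require Import all_classical all_reals all_analysis.
From mathcomp Require Import ring lra zify.

Set Implicit Arguments.
Unset Strict Implicit.
Unset Printing Implicit Defensive.

Import Order.TTheory GRing.Theory Num.Theory.
Import numFieldNormedType.Exports.

Local Open Scope classical_set_scope.
Local Open Scope ring_scope.

(** * Banach spaces cut out of a module by a norm *)

Section NormSequences.
Variables (R : realType) (U : zmodType) (N : U -> R).

(** [N] is a bare function, so that completeness can be checked for a candidate norm before any
    normed structure exists on the subspace. *)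
Definition norm_cauchy (u : nat -> U) : Prop :=
  forall e, 0 < e -> exists m, forall i j, (m <= i)%N -> (m <= j)%N ->
    N (u i - u j) <= e.

Definition norm_cvg (u : nat -> U) (l : U) : Prop :=
  forall e, 0 < e -> exists m, forall i, (m <= i)%N -> N (u i - l) <= e.

End NormSequences.

Lemma norm_cauchy_cvg (R : realType) (W : completeNormedModType R)
    (u : nat -> W) :
  norm_cauchy Num.norm u -> exists l, norm_cvg Num.norm u l.
Proof.
move=> uC; suff /cauchy_cvg/cvg_ex[/= l ul] : cauchy (u @ \oo).
  exists l => e e0.
  have /cvgrPdistC_le/(_ e e0)[m _ um] := ul.
  by exists m => i mi; exact: um.
apply: cauchy_exP => e e0.
have [m um] := uC (e / 2) (divr_gt0 e0 (ltr0Sn R 1)).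
exists (u m), m => // i /= mi; rewrite -ball_normE /=.
apply: le_lt_trans (um m i (leqnn _) mi) _.
by rewrite gtr_pMr// invf_lt1// ltr1n.
Qed.

(** The norm laws are required on the carrier only: the sup norm and the l^p norm used below are
    total functions with conventional values outside it. *)
Record banach_subspace (R : realType) (U : lmodType R) := BanachSubspace {
  bs_carrier : set U;
  bs_norm : U -> R;
  bs_carrier0 : bs_carrier 0;
  bs_carrierP : forall c x y,
    bs_carrier x -> bs_carrier y -> bs_carrier (c *: x + y);
  bs_normD : forall x y, bs_carrier x -> bs_carrier y ->
    bs_norm (x + y) <= bs_norm x + bs_norm y;
  bs_normZ : forall c x, bs_carrier x -> bs_norm (c *: x) = `|c| * bs_norm x;
  bs_norm_eq0 : forall x, bs_carrier x -> bs_norm x = 0 -> x = 0;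
  bs_complete : forall u : nat -> U, (forall i, bs_carrier (u i)) ->
    norm_cauchy bs_norm u -> exists2 l, bs_carrier l & norm_cvg bs_norm u l
}.

Section BanachSubspaceType.
Variables (R : realType) (U : lmodType R) (B : banach_subspace U).

Definition bs_pred : pred U := fun x => `[< bs_carrier B x >].

Lemma bs_pred_closed : submod_closed bs_pred.
Proof.
split; first exact/asboolP/bs_carrier0.
by move=> c x y /asboolP Bx /asboolP By; apply/asboolP/bs_carrierP.
Qed.
HB.instance Definition _ := GRing.isSubmodClosed.Build R U bs_pred
  (GRing.submod_closed_semi bs_pred_closed).

Record bs_type := BSType { bs_val : U ; _ : bs_val \in bs_pred }.
HB.instance Definition _ := [isSub for bs_val].
HB.instance Definition _ := [Choice of bs_type by <:].
HB.instance Definition _ := [SubChoice_isSubLmodule of bs_type by <:].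

Lemma bs_valP (x : bs_type) : bs_carrier B (bs_val x).
Proof. by case: x => x /= /asboolP. Qed.

Definition bs_mk (x : U) (Bx : bs_carrier B x) : bs_type :=
  BSType (introT (asboolP _) Bx).

Let nrm (x : bs_type) : R := bs_norm B (bs_val x).

Let nrmD x y : nrm (x + y) <= nrm x + nrm y.
Proof. by apply: bs_normD; exact: bs_valP. Qed.

Let nrmZ (c : R) x : nrm (c *: x) = `|c| * nrm x.
Proof. by apply: bs_normZ; exact: bs_valP. Qed.

Let nrm_eq0 x : nrm x = 0 -> x = 0.
Proof. by move=> x0; apply: val_inj; exact: bs_norm_eq0 (bs_valP x) x0. Qed.

HB.instance Definition _ :=
  Lmodule_isNormed.Build R bs_type nrmD nrmZ nrm_eq0.

Lemma bs_normE (x : bs_type) : `|x| = bs_norm B (bs_val x).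
Proof. by []. Qed.

(** Sequential completeness suffices: balls of radius [1/(i+1)] belonging to [F] have centres that
    form a Cauchy sequence, since two members of a proper filter meet, and the limit of the centres
    is a limit of [F]. *)
Lemma bs_type_complete (F : set_system bs_type) :
  ProperFilter F -> cauchy F -> cvg F.
Proof.
move=> FF /cauchyP Fc.
have /choice[x Fx] i : exists x, F (ball x (i.+1%:R^-1 : R)).
  by apply: Fc; rewrite invr_gt0 ltr0Sn.
have xx i j : `|x i - x j| < i.+1%:R^-1 + j.+1%:R^-1.
  have [y []] := filter_ex (filterI (Fx i) (Fx j)).
  rewrite -!ball_normE /= => xi xj.
  rewrite (le_lt_trans (ler_distD y _ _))// [ltRHS]addrC -[ltLHS]addrC.
  by rewrite ltrD// distrC.
have inv_le e : 0 < e -> exists m, forall i, (m <= i)%N -> i.+1%:R^-1 <= e :> R.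
  move=> e0; exists (Num.truncn e^-1) => i mi.
  rewrite -[leRHS]invrK lef_pV2 ?posrE ?invr_gt0// ltW//.
  by rewrite (lt_le_trans (Num.Theory.truncnS_gt _))// ler_nat.
have xC : norm_cauchy (bs_norm B) (fun i => bs_val (x i)).
  move=> e e0; have [m me] := inv_le (e / 2) (divr_gt0 e0 (ltr0Sn R 1)).
  exists m => i j mi mj; apply: (@le_trans _ _ `|x i - x j|) => //.
  by rewrite (le_trans (ltW (xx i j)))// [e]splitr lerD// me.
have [l Bl xl] := bs_complete (fun i => bs_valP (x i)) xC.
apply/cvg_ex; exists (bs_mk Bl); apply/cvgrPdistC_le => e e0.
have [m1 me] := inv_le (e / 2) (divr_gt0 e0 (ltr0Sn R 1)).
have [m2 ml] := xl (e / 2) (divr_gt0 e0 (ltr0Sn R 1)).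
set m := maxn m1 m2.
apply: filterS (Fx m) => y; rewrite -ball_normE /= => xy.
rewrite (le_trans (ler_distD (x m) _ _))// [e]splitr lerD//.
  by rewrite distrC (le_trans (ltW xy))// me// leq_maxl.
by rewrite bs_normE ml// leq_maxr.
Qed.

HB.instance Definition _ := Uniform_isComplete.Build bs_type bs_type_complete.

End BanachSubspaceType.

(** * The open mapping theorem and stability of exactness *)

Section LinearMaps.
Variables (R : realType) (U W : lmodType R) (T : U -> W).
Hypothesis linT : linear T.

Lemma lin_sub x y : T (x - y) = T x - T y.
Proof. by rewrite addrC -scaleN1r linT scaleN1r addrC. Qed.

Lemma lin0 : T 0 = 0.
Proof. by rewrite -[0 in LHS](subrr 0) lin_sub subrr. Qed.

Lemma lin_add x y : T (x + y) = T x + T y.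
Proof. by rewrite -[x in LHS]scale1r linT scale1r. Qed.

Lemma lin_scale c x : T (c *: x) = c *: T x.
Proof. by rewrite -[c *: x]addr0 linT lin0 addr0. Qed.

End LinearMaps.

Lemma half_power_le (R : realType) (K e : R) : 0 < e ->
  exists m, forall i, (m <= i)%N -> K * 2^-1 ^+ i <= e.
Proof.
move=> e0; exists (Num.truncn (`|K| / e)).+1 => i mi.
apply: (@le_trans _ _ (`|K| * 2^-1 ^+ i)).
  by rewrite ler_wpM2r ?ler_norm// exprn_ge0.
rewrite exprVn ler_pdivrMr ?exprn_gt0// mulrC -ler_pdivrMr//.
rewrite (le_trans (ltW (Num.Theory.truncnS_gt _)))//.
by rewrite -natrX ler_nat (leq_trans mi)// ltnW// ltn_expl.
Qed.

Lemma norm_cvg_small (R : realType) (W : normedModType R) (w : W) (M : R) :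
  (forall e, 0 < e -> `|w| <= M * e) -> w = 0.
Proof.
move=> wM; apply/normr0_eq0/eqP; rewrite eq_le normr_ge0 andbT.
apply/ler_addgt0Pr => e e0; rewrite add0r.
have M0 : 0 < `|M| + 1 by rewrite ltr_wpDl.
apply: le_trans (wM (e / (`|M| + 1)) _) _; first by rewrite divr_gt0.
rewrite mulrCA ger_pMr// ler_pdivrMr// mul1r.
by rewrite (le_trans (ler_norm _))// lerDl.
Qed.

(** The residuals [r k] at least halve at each step, so their approximate preimages [g (r k)] form a
    convergent series whose sum is an exact preimage. The set [Z] lets one scheme serve both the
    range of a map and the kernel of a perturbed map. *)
Lemma iterated_approximation (R : realType) (A : completeNormedModType R)
    (B : normedModType R) (T : A -> B) (M C : R) (Z : set B) :
  linear T -> (forall x, `|T x| <= M * `|x|) ->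
  (forall z, Z z -> exists x,
     [/\ `|x| <= C * `|z|, Z (z - T x) & `|z - T x| <= 2^-1 * `|z|]) ->
  forall z, Z z -> exists x, T x = z /\ `|x| <= 2 * C * `|z|.
Proof.
move=> linT bT approx z Zz.
have /choice[g gP] (y : B) : exists x, Z y ->
    [/\ `|x| <= C * `|y|, Z (y - T x) & `|y - T x| <= 2^-1 * `|y|].
  have [/approx[x xP]|nZ] := pselect (Z y); first by exists x.
  by exists 0.
pose r i := iter i (fun y => y - T (g y)) z.
pose x i := \sum_(k < i) g (r k).
have Zr i : Z (r i).
  by elim: i => //= i Zi; have [] := gP _ Zi.
have rle i : `|r i| <= 2^-1 ^+ i * `|z|.
  elim: i => [|i IH]; first by rewrite expr0 mul1r.
  have [_ _ /= h] := gP _ (Zr i).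
  by rewrite (le_trans h)// exprS -mulrA ler_wpM2l.
have Tx i : z - T (x i) = r i.
  elim: i => [|i IH]; first by rewrite /x big_ord0 (lin0 linT) subr0.
  by rewrite /x big_ord_recr/= (lin_add linT) opprD addrA IH.
have C0 : 0 <= C * `|z|.
  by have [h _ _] := gP _ Zz; exact: le_trans h.
pose K := 2 * C * `|z|.
(* The bound is a difference, so it telescopes; it gives the Cauchy property and, from [i = 0], the
   estimate on the limit. *)
have xd i d : `|x (i + d)%N - x i| <= K * 2^-1 ^+ i - K * 2^-1 ^+ (i + d).
  elim: d => [|d IH]; first by rewrite addn0 !subrr normr0.
  have xS j : x j.+1 = x j + g (r j) by rewrite /x big_ord_recr.
  rewrite addnS xS addrAC (le_trans (ler_normD _ _))//.
  have [h _ _] := gP _ (Zr (i + d)%N).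
  (* Only [C] times the norm of [z] is known to be nonnegative; when [z = 0] the sign of [C] is
     unknown, but all residuals vanish. *)
  have Cge : 0 <= C \/ `|z| = 0.
    have [->|z0] := eqVneq `|z| 0; [by right|left].
    by move: C0; rewrite pmulr_lge0// lt_neqAle eq_sym z0 normr_ge0.
  have {}h : `|g (r (i + d)%N)| <= C * (2^-1 ^+ (i + d) * `|z|).
    apply: le_trans h _; case: Cge => [Cge|z0]; first by rewrite ler_wpM2l.
    suff -> : `|r (i + d)%N| = 0 by rewrite z0 !mulr0.
    by apply: le_anti; rewrite normr_ge0 andbT (le_trans (rle _))// z0 mulr0.
  apply: le_trans (lerD IH h) _.
  by rewrite exprS /K le_eqVlt; apply/orP; left; apply/eqP; field.
have K0 : 0 <= K by rewrite /K -mulrA mulr_ge0.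
have pow0 i : 0 <= K * 2^-1 ^+ i by rewrite mulr_ge0// exprn_ge0.
have xC : norm_cauchy Num.norm x.
  move=> e e0; have [m me] := half_power_le K e0.
  exists m => i j mi mj; wlog ij : i j mi mj / (i <= j)%N.
    by move=> h; have [/h|/ltnW/h] := leqP i j; last rewrite distrC; exact.
  rewrite distrC -(subnKC ij) (le_trans (xd _ _))//.
  by rewrite (le_trans _ (me i mi))// lerBlDr lerDl.
have [l xl] := norm_cauchy_cvg xC.
exists l; split.
  apply/esym/eqP; rewrite -subr_eq0; apply/eqP.
  apply: (@norm_cvg_small _ _ _ (`|M| + 1)) => e e0.
  have [m1 h1] := xl e e0.
  have [m2 h2] := half_power_le `|z| e0.
  set m := maxn m1 m2.
  have -> : z - T l = T (x m - l) + (z - T (x m)).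
    by rewrite (lin_sub linT) [in RHS]addrC addrA subrK.
  rewrite mulrDl mul1r (le_trans (ler_normD _ _))// lerD//.
    rewrite (le_trans (bT _))// (@le_trans _ _ (`|M| * `|x m - l|))//.
      by rewrite ler_wpM2r ?ler_norm.
    by rewrite ler_wpM2l// h1// leq_maxl.
  by rewrite Tx (le_trans (rle _))// mulrC h2// leq_maxr.
apply/ler_addgt0Pr => e e0; have [m h] := xl e e0.
rewrite -[l](subrK (x m)) (le_trans (ler_normD _ _))// [leRHS]addrC lerD//.
  by rewrite distrC h.
have := xd 0 m; rewrite add0n {2}/x big_ord0 subr0 expr0 mulr1 => /le_trans.
by apply; rewrite lerBlDr lerDl.
Qed.

Section RangeBanach.
Variables (R : realType) (A : lmodType R) (B : completeNormedModType R).
Variable T : A -> B.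
Hypothesis linT : linear T.
Hypothesis closedT :
  forall y, (forall e, 0 < e -> exists x, `|y - T x| <= e) -> range T y.

Let range0 : range T 0.
Proof. by exists 0 => //; rewrite (lin0 linT). Qed.

Let rangeP (c : R) x y : range T x -> range T y -> range T (c *: x + y).
Proof. by case=> u _ <- [v _ <-]; exists (c *: u + v) => //; rewrite linT. Qed.

Let range_complete (u : nat -> B) : (forall i, range T (u i)) ->
  norm_cauchy Num.norm u ->
  exists2 l, range T l & norm_cvg Num.norm u l.
Proof.
move=> Tu /norm_cauchy_cvg[l ul]; exists l => //; apply: closedT => e e0.
have [m /(_ m (leqnn _))] := ul e e0.
by have [x _ <-] := Tu m; exists x; rewrite distrC.
Qed.

(** Baire's theorem is to be applied inside the range, which is a Banach space since [closedT] makes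
    it closed in [B]. *)
Definition range_banach : banach_subspace B :=
  BanachSubspace range0 rangeP (fun x y _ _ => ler_normD x y)
    (fun c x _ => normrZ c x) (fun x _ => @normr0_eq0 _ _ x) range_complete.

End RangeBanach.

(** The images [D n] of balls cover the range, so by Baire the closure of one of them contains a
    ball. Differences move that ball to the origin, and scaling reaches every [y]. *)
Lemma almost_open_mapping (R : realType) (A : normedModType R)
    (B : completeNormedModType R) (T : A -> B) :
  linear T ->
  (forall y, (forall e, 0 < e -> exists x, `|y - T x| <= e) -> range T y) ->
  exists C, forall y, range T y ->
    exists x, `|x| <= C * `|y| /\ `|y - T x| <= 2^-1 * `|y|.
Proof.
move=> linT clT; pose Y := bs_type (range_banach linT clT).
pose D n := [set y : Y | exists x, `|x| <= n%:R /\ T x = bs_val y].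
have [n nD] : exists n, ~ dense (~` closure (D n)).
  apply: contrapT => /forallNP dD.
  have /Baire dI i : open (~` closure (D i)) /\ dense (~` closure (D i)).
    by split; [exact/closed_openC/closed_closure | exact: contrapT (dD i)].
  have I0 : \bigcap_i (~` closure (D i)) = set0.
    apply/seteqP; split => // y yD.
    have [x _ xy] := bs_valP y.
    apply: (yD (Num.truncn `|x|).+1 I); apply: subset_closure.
    by exists x; split => //; exact/ltW/Num.Theory.truncnS_gt.
  by apply: (@dense0 Y); rewrite -I0.
have [Q [[p [Qop Qp]] /disjoints_subset]] := denseNE nD.
rewrite setCK => QD.
have /nbhs_ballP[r /= r0 pr] : nbhs p Q by apply: open_nbhs_nbhs.
(* Approximate preimages of [p + y] and [p] are subtracted, which doubles both the norm bound and
   the error. *)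
have nearby (y : Y) : `|y| < r -> forall d, 0 < d ->
    exists x, `|x| <= 2 * n%:R /\ `|bs_val y - T x| <= 2 * d.
  move=> yr d d0.
  have app (q : Y) : ball p r q ->
      exists x, `|x| <= n%:R /\ `|bs_val q - T x| <= d.
    move=> /pr/QD/(_ _ (nbhsx_ballx q d d0))[w [[x [xn xw]]]].
    by rewrite -ball_normE /= => /ltW qw; exists x; rewrite xw.
  have [x1 [x1n x1d]] : exists x, `|x| <= n%:R /\ `|bs_val p - T x| <= d.
    by apply/app/ballxx.
  have [x2 [x2n x2d]] : exists x, `|x| <= n%:R /\ `|bs_val (p + y) - T x| <= d.
    by apply: app; rewrite -ball_normE /= opprD addNKr normrN.
  exists (x2 - x1); split.
    by rewrite (le_trans (ler_normB _ _))// mulr_natl mulr2n lerD.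
  have -> : bs_val y - T (x2 - x1)
      = (bs_val (p + y) - T x2) - (bs_val p - T x1).
    rewrite (lin_sub linT) (_ : bs_val (p + y) = bs_val p + bs_val y)//.
    rewrite -(addrA (bs_val p)) !opprB [_ - bs_val p]addrC addrACA subrr add0r.
    by rewrite addrA addrAC.
  by rewrite (le_trans (ler_normB _ _))// mulr_natl mulr2n lerD.
exists (4 * n%:R / r) => y Ty.
have [->|y0] := eqVneq y 0.
  by exists 0; rewrite (lin0 linT) subrr !normr0 !mulr0.
have ny0 : 0 < `|y| by rewrite normr_gt0.
(* The factor [s] brings [y] to norm [r/2]; with [d = r/8] below, the error is at most [r/4], half
   of that. *)
pose s := r / (2 * `|y|).
have s0 : 0 < s by rewrite divr_gt0// mulr_gt0.
have sy : `|s *: y| < r.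
  have -> : `|s *: y| = r / 2.
    by rewrite normrZ gtr0_norm// /s; field; rewrite gt_eqF.
  by rewrite gtr_pMr// invf_lt1// ltr1n.
pose yY : Y := bs_mk (B := range_banach linT clT) Ty.
have syE : bs_val (s *: yY) = s *: y by [].
have [||x [xn xy]] := nearby (s *: yY) _ (r / 8).
- by rewrite bs_normE.
- by rewrite divr_gt0.
exists (s^-1 *: x); split.
  rewrite normrZ gtr0_norm ?invr_gt0// mulrC ler_pdivrMr//.
  rewrite (le_trans xn)// /s le_eqVlt; apply/orP; left; apply/eqP.
  by field; rewrite !gt_eqF.
have -> : y - T (s^-1 *: x) = s^-1 *: (s *: y - T x).
  by rewrite (lin_scale linT) scalerBr scalerK// gt_eqF.
rewrite normrZ gtr0_norm ?invr_gt0// mulrC ler_pdivrMr//.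
rewrite -syE (le_trans xy)// /s le_eqVlt; apply/orP; left; apply/eqP.
by field; rewrite gt_eqF.
Qed.

(** Residuals [z - T x] stay in the range, so the approximate preimages can be iterated with
    [Z = range T]. *)
Theorem open_mapping (R : realType) (A B : completeNormedModType R)
    (T : A -> B) (M : R) :
  linear T -> (forall x, `|T x| <= M * `|x|) ->
  (forall y, (forall e, 0 < e -> exists x, `|y - T x| <= e) -> range T y) ->
  exists2 C, 0 < C &
    forall y, range T y -> exists x, T x = y /\ `|x| <= C * `|y|.
Proof.
move=> linT bT clT; have [C CP] := almost_open_mapping linT clT.
have h z : range T z -> exists x, T x = z /\ `|x| <= 2 * C * `|z|.
  apply: (iterated_approximation linT bT) => {}z Tz.
  have [x [xC zx]] := CP z Tz; exists x; split => //.
  by case: Tz => w _ <-; exists (w - x) => //; rewrite (lin_sub linT).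
exists (2 * `|C| + 1) => [|y /h[x [Tx xy]]].
  by rewrite ltr_wpDl// mulr_ge0.
exists x; split=> //; rewrite (le_trans xy)// ler_wpM2r//.
by rewrite (le_trans (ler_norm _))// normrM ger0_norm// lerDl.
Qed.

(** If [S1 z = 0], then [T1 z = (T1 - S1) z] is small and lifts to a small [v]; exactness gives
    [z - v = T0 u]. The error [z - S0 u = v + (T0 - S0) u] is small and again killed by [S1],
    because [S1] kills the range of [S0], so the correction can be iterated. *)
Theorem exactness_stable (R : realType) (A B C : completeNormedModType R)
    (T0 : A -> B) (T1 : B -> C) (M0 M1 : R) :
  linear T0 -> (forall x, `|T0 x| <= M0 * `|x|) ->
  linear T1 -> (forall x, `|T1 x| <= M1 * `|x|) ->
  (forall b, T1 b = 0 <-> range T0 b) ->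
  (forall y, (forall e, 0 < e -> exists x, `|y - T1 x| <= e) -> range T1 y) ->
  exists2 eta, 0 < eta & forall (S0 : A -> B) (S1 : B -> C),
    linear S0 -> linear S1 ->
    (forall x, `|T0 x - S0 x| <= eta * `|x|) ->
    (forall x, `|T1 x - S1 x| <= eta * `|x|) ->
    (forall x, S1 (S0 x) = 0) ->
    forall b, S1 b = 0 -> range S0 b.
Proof.
move=> lin0 b0 lin1 b1 ker_range cl1.
(* The range of [T0] is the kernel of the bounded map [T1], hence closed. *)
have cl0 y : (forall e, 0 < e -> exists x, `|y - T0 x| <= e) -> range T0 y.
  move=> yT; apply/ker_range/(@norm_cvg_small _ _ _ `|M1|) => e e0.
  have [x xe] := yT e e0.
  have T10 : T1 (T0 x) = 0 by apply/ker_range; exists x.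
  rewrite -[T1 y]subr0 -T10 -(lin_sub lin1) (le_trans (b1 _))//.
  apply: (@le_trans _ _ (`|M1| * `|y - T0 x|)); last by rewrite ler_wpM2l.
  by rewrite ler_wpM2r// ler_norm.
have [K0 K00 h0] := open_mapping lin0 b0 cl0.
have [K1 K10 h1] := open_mapping lin1 b1 cl1.
pose K := K0 + K1; have K_gt0 : 0 < K by rewrite addr_gt0.
have K0K : K0 <= K by rewrite /K lerDl ltW.
have K1K : K1 <= K by rewrite /K lerDr ltW.
(* With this value [v] has norm at most 1/6, and [(T0 - S0) u] at most 1/3, of the norm of [z]:
   together the required 1/2. *)
exists (6 * K)^-1 => [|S0 S1 linS0 linS1 bS0 bS1 SS b Sb].
  by rewrite invr_gt0 mulr_gt0.
have bS x : `|S0 x| <= (`|M0| + (6 * K)^-1) * `|x|.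
  rewrite -[S0 x](subrK (T0 x)) (le_trans (ler_normD _ _))// mulrDl addrC.
  apply: lerD; last by rewrite distrC.
  by rewrite (le_trans (b0 _))// ler_wpM2r// ler_norm.
suff [w [Sw _]] : exists w, S0 w = b /\ `|w| <= 2 * (2 * K) * `|b|.
  by exists w.
apply: (iterated_approximation linS0 bS (Z := [set z | S1 z = 0])) Sb => z /= Sz.
have Tz : `|T1 z| <= (6 * K)^-1 * `|z| by rewrite -[T1 z]subr0 -Sz.
have [|v [Tv vz]] := h1 (T1 z); first by exists z.
have {}vz : `|v| <= 6^-1 * `|z|.
  rewrite (le_trans vz)// (@le_trans _ _ (K * ((6 * K)^-1 * `|z|)))//.
    exact: ler_pM (ltW K10) (normr_ge0 _) K1K Tz.
  by rewrite mulrA invfM mulrCA mulfV ?gt_eqF// mulr1.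
have [|u [Tu uz]] := h0 (z - v).
  by apply/ker_range; rewrite (lin_sub lin1) Tv subrr.
have {}uz : `|u| <= K * (2 * `|z|).
  rewrite (le_trans uz)//; apply: ler_pM (ltW K00) (normr_ge0 _) K0K _.
  have := ler_normB z v; have := normr_ge0 z; lra.
exists u; split; first by rewrite -mulrA mulrCA.
  by rewrite (lin_sub linS1) Sz SS subrr.
have -> : z - S0 u = v + (T0 u - S0 u) by rewrite Tu addrA addrCA subrr addr0.
rewrite (le_trans (ler_normD _ _))//.
have : `|T0 u - S0 u| <= 3^-1 * `|z|.
  apply: le_trans (bS0 _) (le_trans (ler_wpM2l _ uz) _).
    by rewrite invr_ge0 mulr_ge0// ltW.
  by rewrite le_eqVlt; apply/orP; left; apply/eqP; field; rewrite gt_eqF.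
by lra.
Qed.

(** * Bounded functions *)

Section BoundedFunctions.
Variables (R : realType) (I : Type) (W : completeNormedModType R).

Definition bounded_funs : set (I -> W) :=
  [set f | exists M, forall i, `|f i| <= M].

Definition supnorm (f : I -> W) : R := sup (range (fun i => `|f i|)).

Lemma supnorm_ge f i : bounded_funs f -> `|f i| <= supnorm f.
Proof.
move=> [M fM]; apply: ub_le_sup; last by exists i.
by exists M => _ [j _ <-].
Qed.

Lemma supnorm_le (f : I -> W) M : 0 <= M -> (forall i, `|f i| <= M) ->
  supnorm f <= M.
Proof.
move=> M0 fM.
have [r0|/eqP/set0P rn0] := pselect (range (fun i => `|f i|) = set0).
  by rewrite /supnorm r0 sup0.
by apply: ge_sup => // _ [i _ <-].
Qed.

Lemma supnorm_ge0 f : 0 <= supnorm f.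
Proof.
rewrite /supnorm.
have [[[_ [i _ _]] [M fM]]|/sup_out ->//] :=
  pselect (has_sup (range (fun i => `|f i|))).
apply: le_trans (normr_ge0 (f i)) (supnorm_ge i _).
by exists M => j; apply: fM; exists j.
Qed.

Let bounded0 : bounded_funs 0.
Proof. by exists 0 => i; rewrite normr0. Qed.

Let boundedP (c : R) f g : bounded_funs f -> bounded_funs g ->
  bounded_funs (c *: f + g).
Proof.
move=> [M fM] [N gN]; exists (`|c| * M + N) => i.
by rewrite (le_trans (ler_normD _ _))// lerD// normrZ ler_wpM2l.
Qed.

Let supnormD f g : bounded_funs f -> bounded_funs g ->
  supnorm (f + g) <= supnorm f + supnorm g.
Proof.
move=> bf bg; apply: supnorm_le => [|i]; first by rewrite addr_ge0// supnorm_ge0.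
by rewrite (le_trans (ler_normD _ _))// lerD// supnorm_ge.
Qed.

Let supnormZ (c : R) f : bounded_funs f -> supnorm (c *: f) = `|c| * supnorm f.
Proof.
move=> bf; apply: le_anti; apply/andP; split.
  apply: supnorm_le => [|i]; first by rewrite mulr_ge0// supnorm_ge0.
  by rewrite normrZ ler_wpM2l// supnorm_ge.
have [->|c0] := eqVneq c 0; first by rewrite normr0 mul0r supnorm_ge0.
have nc0 : 0 < `|c| by rewrite normr_gt0.
rewrite -ler_pdivlMl//; apply: supnorm_le => [|i].
  by rewrite mulr_ge0 ?invr_ge0 ?supnorm_ge0.
rewrite ler_pdivlMl// -normrZ; apply: (@supnorm_ge (c *: f)).
by rewrite -[_ *: _]addr0; exact: boundedP.
Qed.

Let supnorm_eq0 f : bounded_funs f -> supnorm f = 0 -> f = 0.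
Proof.
move=> bf f0; apply/funext => i; apply/normr0_eq0/eqP.
by rewrite eq_le normr_ge0 andbT -f0 supnorm_ge.
Qed.

Let bounded_complete (u : nat -> I -> W) : (forall k, bounded_funs (u k)) ->
  norm_cauchy supnorm u ->
  exists2 l, bounded_funs l & norm_cvg supnorm u l.
Proof.
move=> bu uC.
have bB j k : bounded_funs (u j - u k).
  by rewrite addrC -scaleN1r; exact: boundedP.
have /choice[l ul] i : exists l, norm_cvg Num.norm (u ^~ i) l.
  apply: norm_cauchy_cvg => e /uC[m um]; exists m => j k mj mk.
  by apply: le_trans (um j k mj mk); exact: (supnorm_ge i (bB j k)).
(* Letting the second index tend to infinity at each point turns the Cauchy bound into a uniform
   bound against [l]. *)
have unif e : 0 < e -> exists m, forall k, (m <= k)%N ->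
    forall i, `|u k i - l i| <= e.
  move=> e0; have [m um] := uC e e0; exists m => k mk i.
  apply/ler_addgt0Pr => d d0; have [m' um'] := ul i d d0.
  pose j := maxn m m'.
  rewrite -[u k i](subrK (u j i)) -addrA (le_trans (ler_normD _ _))// lerD//.
    have := um k j mk (leq_maxl _ _); apply: le_trans.
    exact: (supnorm_ge i (bB k j)).
  by apply: um'; exact: leq_maxr.
exists l.
  have [m /(_ m (leqnn _)) ml] := unif 1 ltr01; have [M uM] := bu m.
  exists (M + 1) => i; rewrite -[l i](subKr (u m i)).
  by rewrite (le_trans (ler_normB _ _))// lerD.
move=> e e0; have [m um] := unif e e0; exists m => k mk.
by apply: supnorm_le => [|i]; [exact: ltW|exact: um].
Qed.

Definition linfty : banach_subspace (I -> W) :=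
  BanachSubspace bounded0 boundedP supnormD supnormZ supnorm_eq0
    bounded_complete.

End BoundedFunctions.

(** * Minkowski's inequality and the l^p norm *)

Section PowerSums.
Variables (R : realType) (p : R).
Hypothesis p_ge1 : 1 <= p.

Let p_gt0 : 0 < p. Proof. exact: lt_le_trans p_ge1. Qed.
Let p_neq0 : p != 0. Proof. by rewrite gt_eqF. Qed.

Lemma powR_le (x y : R) : 0 <= x -> x <= y -> x `^ p <= y `^ p.
Proof.
move=> x0 xy; apply: ge0_ler_powR; rewrite ?nnegrE ?(ltW p_gt0)//.
exact: le_trans xy.
Qed.

Lemma powR_leK (x y : R) : 0 <= x -> 0 <= y -> x `^ p <= y `^ p -> x <= y.
Proof.
move=> x0 y0; apply: contraTT; rewrite -!ltNge => yx.
by apply: gt0_ltr_powR.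
Qed.

Lemma powR_wconvex (t x y : R) : 0 <= t -> t <= 1 -> 0 <= x -> 0 <= y ->
  (t * x + (1 - t) * y) `^ p <= t * x `^ p + (1 - t) * y `^ p.
Proof.
move=> t0 t1 x0 y0.
have := @convex_powR R p p_ge1 (Itv01 t0 t1) x y.
by rewrite !convRE /=; apply; rewrite inE /= in_itv /= andbT.
Qed.

Variables (I : choiceType) (W : normedModType R).
Implicit Types (f g : I -> W) (s : seq I) (D : set I).

(** Convexity of the [p]-th power is applied to [f/a] and [g/b] with weights [a/(a+b)] and
    [b/(a+b)]. A zero bound, which cannot be divided by, forces the corresponding function to vanish
    on [s]. *)
Lemma minkowski_seq s f g (a b : R) : 0 <= a -> 0 <= b ->
  \sum_(t <- s) `|f t| `^ p <= a `^ p ->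
  \sum_(t <- s) `|g t| `^ p <= b `^ p ->
  \sum_(t <- s) `|f t + g t| `^ p <= (a + b) `^ p.
Proof.
have vanish h : \sum_(t <- s) `|h t| `^ p <= 0 ->
    forall t, t \in s -> h t = 0 :> W.
  move=> h0 t ts; apply/normr0_eq0/(@powR_eq0_eq0 _ _ p)/eqP.
  have /eqP : \sum_(t <- s) `|h t| `^ p = 0.
    by apply/le_anti; rewrite h0 sumr_ge0// => i _; rewrite powR_ge0.
  rewrite psumr_eq0 => [/allP/(_ t ts)//|i _]; exact: powR_ge0.
rewrite le_eqVlt => /predU1P[<-|a0].
  move=> b0; rewrite powR0// => /vanish f0 gb; rewrite add0r.
  by rewrite (eq_big_seq (fun t => `|g t| `^ p))// => t /f0 ->; rewrite add0r.
rewrite le_eqVlt => /predU1P[<-|b0].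
  move=> fa; rewrite powR0// => /vanish g0; rewrite addr0.
  by rewrite (eq_big_seq (fun t => `|f t| `^ p))// => t /g0 ->; rewrite addr0.
have powRV x : 0 <= x -> x^-1 `^ p = (x `^ p)^-1.
  by move=> x0; rewrite -(powR_inv1 x0) -powRrM mulN1r powRN.
move=> fa gb; set c := a + b; have c0 : 0 < c by rewrite addr_gt0.
pose t := a / c; have t0 : 0 <= t by rewrite divr_ge0// ltW.
have t1 : t <= 1 by rewrite ler_pdivrMr// mul1r lerDl ltW.
have t1E : 1 - t = b / c.
  by rewrite /t; move: c0; rewrite /c => c0; field; rewrite gt_eqF.
have term i : `|f i + g i| `^ p <=
    c `^ p * (t * (`|f i| `^ p / a `^ p) + (1 - t) * (`|g i| `^ p / b `^ p)).
  have fg : `|f i + g i| <= c * (t * (`|f i| / a) + (1 - t) * (`|g i| / b)).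
    rewrite (le_trans (ler_normD _ _))// t1E /t le_eqVlt; move: c0 => /gt_eqF c0.
    by apply/orP; left; apply/eqP; field; rewrite c0 !gt_eqF.
  have fa0 : 0 <= `|f i| / a by rewrite divr_ge0// ltW.
  have gb0 : 0 <= `|g i| / b by rewrite divr_ge0// ltW.
  rewrite (le_trans (powR_le _ fg))// powRM//; last 2 first.
  - exact: ltW.
  - by rewrite addr_ge0// mulr_ge0// subr_ge0.
  rewrite ler_wpM2l ?powR_ge0//.
  apply: le_trans (powR_wconvex t0 t1 fa0 gb0) _.
  have [a0' b0'] := (ltW a0, ltW b0).
  by rewrite !powRM ?invr_ge0// !powRV.
apply: le_trans (ler_sum _ (fun i _ => term i)) _.
rewrite -mulr_sumr big_split/= -!mulr_sumr -!mulr_suml.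
rewrite -[leRHS]mulr1 ler_wpM2l ?powR_ge0//.
apply: (@le_trans _ _ (t * 1 + (1 - t) * 1)); last by rewrite !mulr1 subrKC.
apply: lerD; apply: ler_wpM2l; rewrite ?subr_ge0//.
  by rewrite ler_pdivrMr ?powR_gt0// mul1r.
by rewrite ler_pdivrMr ?powR_gt0// mul1r.
Qed.

Definition lpnorm_on D f : \bar R :=
  ((\esum_(t in D) (`|f t| `^ p)%:E) `^ p^-1)%E.

(** A sum of nonnegative terms is the supremum of its finite partial sums, and [p]-th powers are
    monotone; l^p estimates are thereby reduced to finite sums. *)
Lemma lpnorm_on_leP D f (r : R) : 0 <= r ->
  (lpnorm_on D f <= r%:E)%E <->
  (forall s, uniq s -> (forall t, t \in s -> D t) ->
     \sum_(t <- s) `|f t| `^ p <= r `^ p).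
Proof.
move=> r0; set S := (\esum_(t in D) (`|f t| `^ p)%:E)%E.
have S0 : (0 <= S)%E by apply: esum_ge0 => t _; rewrite lee_fin powR_ge0.
have -> : ((lpnorm_on D f <= r%:E) <-> (S <= (r `^ p)%:E))%E.
  rewrite /lpnorm_on -/S; split=> h.
    rewrite -[S]poweRe1// -(mulVf p_neq0) poweRrM -poweR_EFin.
    apply: gt0_ler_poweR h; first exact: ltW.
      by rewrite in_itv/= leey poweR_ge0.
    by rewrite in_itv/= leey lee_fin r0.
  rewrite -[r]powRr1// -(mulfV p_neq0) powRrM -poweR_EFin.
  apply: gt0_ler_poweR h; first by rewrite invr_ge0 ltW.
    by rewrite in_itv/= leey S0.
  by rewrite in_itv/= leey lee_fin powR_ge0.
split=> [h s us sD|h].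
  rewrite -lee_fin; apply: le_trans h; apply: esum_ge.
  exists [set` s]; first by split; [exact: finite_seq|].
  by rewrite fsumEFin; [rewrite -fsbig_seq|exact: finite_seq].
apply: ge_ereal_sup => _ [X [finX XD] <-].
rewrite fsumEFin// lee_fin fsbig_finite//=; apply: h => // t.
by rewrite in_fset_set// inE => /XD.
Qed.

Lemma lpnorm_on_pt D f (r : R) t : 0 <= r -> (lpnorm_on D f <= r%:E)%E ->
  D t -> `|f t| <= r.
Proof.
move=> r0 /lpnorm_on_leP -/(_ r0)/(_ [:: t] isT) fr Dt.
apply: powR_leK => //.
by have := fr _; rewrite big_seq1; apply=> u; rewrite inE => /eqP ->.
Qed.

Lemma lpnorm_onD D f g (a b : R) : 0 <= a -> 0 <= b ->
  (lpnorm_on D f <= a%:E)%E -> (lpnorm_on D g <= b%:E)%E ->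
  (lpnorm_on D (f + g)%R <= (a + b)%:E)%E.
Proof.
move=> a0 b0 /lpnorm_on_leP -/(_ a0) fa /lpnorm_on_leP -/(_ b0) gb.
apply/lpnorm_on_leP => [|s us sD]; first exact: addr_ge0.
by apply: minkowski_seq => //; [exact: fa|exact: gb].
Qed.

Lemma lpnorm_onZ D f (c r : R) : 0 <= r -> (lpnorm_on D f <= r%:E)%E ->
  (lpnorm_on D (c *: f)%R <= (`|c| * r)%:E)%E.
Proof.
move=> r0 /lpnorm_on_leP -/(_ r0) fr.
apply/lpnorm_on_leP => [|s us sD]; first exact: mulr_ge0.
under eq_bigr do rewrite normrZ powRM//.
by rewrite -mulr_sumr powRM// ler_wpM2l ?powR_ge0// fr.
Qed.

Lemma lpnorm_on0 D : lpnorm_on D 0 = 0%E.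
Proof.
by rewrite /lpnorm_on esum1 ?poweR0r ?invr_eq0// => t _; rewrite normr0 powR0.
Qed.

(** Lower semicontinuity of the l^p norm, in the manner of Fatou: on a finite [s] pointwise
    convergence is uniform, and Minkowski's inequality controls the error. *)
Lemma lpnorm_on_lim D (u : nat -> I -> W) l (r : R) m : 0 <= r ->
  (forall t, D t -> norm_cvg Num.norm (u ^~ t) (l t)) ->
  (forall k, (m <= k)%N -> (lpnorm_on D (u k) <= r%:E)%E) ->
  (lpnorm_on D l <= r%:E)%E.
Proof.
move=> r0 ul ur; apply/lpnorm_on_leP => // s us sD.
(* [K] is the l^p norm of the constant 1 on [s], so a uniform error [d] costs [K * d]. *)
pose K := ((size s)%:R : R) `^ p^-1.
have Kp : K `^ p = (size s)%:R by rewrite -powRrM mulVf// powRr1.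
have K0 : 0 <= K by exact: powR_ge0.
have unif e : 0 < e -> exists k, forall j, (k <= j)%N ->
    forall t, t \in s -> `|u j t - l t| <= e.
  move=> e0; elim: (s) sD => [|t s' IH] sD; first by exists 0%N.
  have [k1 h1] := ul t (sD t (mem_head _ _)) e e0.
  have [|k2 h2] := IH; first by move=> t' ts; apply: sD; rewrite inE ts orbT.
  exists (maxn k1 k2) => j; rewrite geq_max => /andP[k1j k2j] t'.
  by rewrite inE => /predU1P[->|]; [exact: h1|exact: h2].
set S := \sum_(t <- s) _.
have S0 : 0 <= S by apply: sumr_ge0 => i _; exact: powR_ge0.
have -> : S = (S `^ p^-1) `^ p by rewrite -powRrM mulVf// powRr1.
apply: powR_le; first exact: powR_ge0.
apply/ler_addgt0Pr => e e0.
have d0 : 0 < e / (K + 1) by rewrite divr_gt0// ltr_wpDl.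
have [k uk] := unif _ d0; pose j := maxn m k.
have Ke : K * (e / (K + 1)) <= e.
  by rewrite mulrCA ger_pMr// ler_pdivrMr ?ltr_wpDl// mul1r lerDl.
apply: (@le_trans _ _ (r + K * (e / (K + 1)))); last by rewrite lerD2l.
apply: powR_leK; first exact: powR_ge0.
  by rewrite addr_ge0// mulr_ge0// ltW.
rewrite -powRrM mulVf// powRr1//.
have -> : S = \sum_(t <- s) `|u j t + (l t - u j t)| `^ p.
  by apply: eq_bigr => t _; rewrite addrC subrK.
apply: minkowski_seq => //; first by rewrite mulr_ge0// ltW.
  by have /lpnorm_on_leP -/(_ r0) := ur j (leq_maxl _ _); exact.
have d0' := ltW d0; rewrite powRM// Kp -sum1_size natr_sum mulr_suml.
rewrite big_seq [leRHS]big_seq; apply: ler_sum => t ts.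
by rewrite mul1r powR_le// distrC uk ?leq_maxr.
Qed.

End PowerSums.

Lemma le_lpnorm_on (R : realType) (p : R) (I : choiceType)
    (W W' : normedModType R) (D : set I) (f : I -> W) (g : I -> W') : 1 <= p ->
  (forall t, D t -> `|f t| <= `|g t|) ->
  (lpnorm_on p D f <= lpnorm_on p D g)%E.
Proof.
move=> p1 fg; have p0 : 0 <= p by rewrite (le_trans _ p1).
have pos (W0 : normedModType R) (h : I -> W0) :
    \esum_(t in D) (`|h t| `^ p)%:E \in `[0%E, +oo%E] :> bool.
  by rewrite in_itv/= leey andbT; apply: esum_ge0 => t _; rewrite lee_fin powR_ge0.
apply: gt0_ler_poweR (pos _ f) (pos _ g) _; first by rewrite invr_ge0.
by apply: le_esum => t Dt; rewrite lee_fin powR_le// fg.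
Qed.

(** * The Banach spaces of cochains *)

Lemma norm_cvg_unique (R : realType) (W : normedModType R) (u : nat -> W) l l' :
  norm_cvg Num.norm u l -> norm_cvg Num.norm u l' -> l = l'.
Proof.
move=> ul ul'; apply/eqP; rewrite -subr_eq0; apply/eqP.
apply: (@norm_cvg_small _ _ _ 2) => e e0.
have [m1 h1] := ul e e0; have [m2 h2] := ul' e e0; pose m := maxn m1 m2.
rewrite -[l](subrK (u m)) -addrA (le_trans (ler_normD _ _))//.
rewrite mulr_natl mulr2n lerD//; first by rewrite distrC h1 ?leq_maxl.
by rewrite h2 ?leq_maxr.
Qed.

Lemma norm_cvgZ (R : realType) (W : normedModType R) (u : nat -> W) l (c : R) :
  norm_cvg Num.norm u l -> norm_cvg Num.norm (fun i => c *: u i) (c *: l).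
Proof.
move=> ul e e0; have c0 : 0 < `|c| + 1 by rewrite ltr_wpDl.
have [m um] := ul _ (divr_gt0 e0 c0); exists m => i mi.
rewrite -scalerBr normrZ (le_trans (ler_wpM2l (normr_ge0 c) (um i mi)))//.
by rewrite mulrCA ger_pMr// ler_pdivrMr// mul1r lerDl.
Qed.

Section CochainBanach.
Variables (R : realType) (G : groupType) (V : choiceType).
Variables (X : simplicial_complex V) (a : simplicial_action G X).
Variables (F : set {fset V}) (F_dom : fundamental_domain a F).
Variables (p : R) (p_ge1 : 1 <= p).
Variable E : completeNormedModType R.
Variable k : nat.

Lemma dom_eltP (s : {fset V}) : X s -> F (act_simplex a (dom_elt a F s)^-1%g s).
Proof.
move=> /(proj2 F_dom)[g [Fg _]]; rewrite /dom_elt.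
by case: xgetP => [h -> //|/(_ g)].
Qed.

Lemma vertices_act (m : nat) (g : G) (t : m.-tuple V) :
  vertices (act_tuple a g t) = act_simplex a g (vertices t).
Proof.
apply/fsetP => v; rewrite !inE /=; apply/mapP/imfsetP => -[w wt ->].
  by exists w; rewrite ?inE.
by exists w => //; move: wt; rewrite !inE.
Qed.

(** Translating [t] into [F] and putting its vertices in the canonical order changes the value of
    every cochain by the same sign. The norm, a sum over [F], thus controls the values on all
    simplices. *)
Lemma cochain_dom_simplex (t : k.+1.-tuple V) : ordered_simplex X t ->
  exists2 t0, dom_simplices F t0 & exists b : bool,
    forall f : k.+1.-tuple V -> E, cochain a F p f -> f t = (-1) ^+ b *: f t0.
Proof.
move=> [ut Xt]; set g := (dom_elt a F (vertices t))^-1%g.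
pose t1 := act_tuple a g t.
have Ft1 : F (vertices t1) by rewrite vertices_act; exact: dom_eltP.
have ag_inj : injective (a g).
  move=> v w /(congr1 (a g^-1%g)); rewrite -!(Defs.actM a) mulVg.
  by rewrite !(Defs.act1 a).
have ut1 : uniq t1 by rewrite map_inj_uniq.
have sz : size (enum_fset (vertices t1)) == k.+1.
  by rewrite card_fseq undup_id// size_tuple.
pose t0 := Tuple sz.
have vt0 : vertices t0 = vertices t1 by apply/fsetP => v; rewrite !inE.
have : perm_eq t1 t0.
  apply: uniq_perm => // [|v]; first exact: fset_uniq.
  by rewrite [RHS](_ : _ = (v \in vertices t1))// !inE.
move=> /tuple_permP[s t1E].
exists t0; first by split; rewrite vt0.
exists (odd_perm s) => f [_ f_alt f_inv _].
have Ot0 : ordered_simplex X t0.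
  split; first exact: fset_uniq.
  by rewrite vt0; exact: (proj1 F_dom).
by rewrite (f_inv t)// -(f_alt t0 s)//; congr f; apply: val_inj; exact: t1E.
Qed.

Notation C := (@cochain R G V X a F p E k).
Implicit Types f g : k.+1.-tuple V -> E.

Let D := @dom_simplices V F k.

Lemma lpnormE f : lpnorm F p f = lpnorm_on p D f. Proof. by []. Qed.

(** [fine] sends [+oo] to 0, so this is meaningful as a norm only where [lpnorm] is finite, in
    particular on cochains. *)
Definition cochain_norm f : R := fine (lpnorm F p f).

Lemma lpnorm_fin f : (lpnorm F p f < +oo)%E ->
  lpnorm F p f = (cochain_norm f)%:E.
Proof. by move=> ffin; rewrite /cochain_norm fineK// ge0_fin_numE// poweR_ge0. Qed.

Lemma cochain_normE f : C f -> lpnorm F p f = (cochain_norm f)%:E.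
Proof. by case=> _ _ _; exact: lpnorm_fin. Qed.

Lemma cochain_norm_ge0 f : 0 <= cochain_norm f.
Proof. by rewrite fine_ge0// poweR_ge0. Qed.

Lemma cochain_norm_le f (r : R) : C f ->
  (cochain_norm f <= r) = (lpnorm F p f <= r%:E)%E.
Proof. by move=> /cochain_normE ->; rewrite lee_fin. Qed.

Lemma cochain_norm_pt f t : C f -> `|f t| <= cochain_norm f.
Proof.
move=> Cf; have [Ot|nOt] := pselect (ordered_simplex X t); last first.
  by case: Cf => -> // _ _ _; rewrite normr0 cochain_norm_ge0.
have [t0 Dt0 [b ->//]] := cochain_dom_simplex Ot.
rewrite normrZ normrX normrN1 expr1n mul1r.
apply: (lpnorm_on_pt p_ge1 (D := D)) => //; first exact: cochain_norm_ge0.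
by rewrite -lpnormE cochain_normE.
Qed.

Let cochain0 : C 0.
Proof.
split=> // [t s _|]; first by rewrite scaler0.
by rewrite lpnormE lpnorm_on0// ltry.
Qed.

Let cochainP (c : R) f g : C f -> C g -> C (c *: f + g).
Proof.
move=> Cf Cg; have [f0 f_alt f_inv _] := Cf; have [g0 g_alt g_inv _] := Cg.
split=> [t nOt|t s Ot|t Ot|].
- by rewrite !fctE f0// g0// scaler0 addr0.
- by rewrite !fctE f_alt// g_alt// scalerDr !scalerA mulrC.
- by rewrite !fctE [in LHS]f_inv// [in LHS]g_inv.
have nf : (lpnorm_on p D (c *: f)%R <= (`|c| * cochain_norm f)%:E)%E.
  by apply: lpnorm_onZ => //; rewrite ?cochain_norm_ge0// -lpnormE cochain_normE.
have ng : (lpnorm_on p D g <= (cochain_norm g)%:E)%E.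
  by rewrite -lpnormE cochain_normE.
rewrite lpnormE; apply: le_lt_trans (ltry (`|c| * cochain_norm f + cochain_norm g)).
by apply: lpnorm_onD; rewrite ?mulr_ge0 ?cochain_norm_ge0.
Qed.

Let cochainD f g : C f -> C g -> C (f + g).
Proof. by move=> Cf Cg; rewrite -[f]scale1r; exact: cochainP. Qed.

Let cochainZ (c : R) f : C f -> C (c *: f).
Proof. by move=> Cf; rewrite -[_ *: _]addr0; exact: cochainP. Qed.

Let cochainB f g : C f -> C g -> C (f - g).
Proof. by move=> Cf Cg; rewrite addrC -scaleN1r; exact: cochainP. Qed.

Let cochain_normD f g : C f -> C g ->
  cochain_norm (f + g) <= cochain_norm f + cochain_norm g.
Proof.
move=> Cf Cg; rewrite cochain_norm_le; last exact: cochainD.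
by apply: lpnorm_onD; rewrite ?cochain_norm_ge0// -lpnormE cochain_normE.
Qed.

Let cochain_norm_leZ (c : R) f : C f ->
  cochain_norm (c *: f) <= `|c| * cochain_norm f.
Proof.
move=> Cf; rewrite cochain_norm_le; last exact: cochainZ.
by apply: lpnorm_onZ; rewrite ?cochain_norm_ge0// -lpnormE cochain_normE.
Qed.

Let cochain_normZ (c : R) f : C f ->
  cochain_norm (c *: f) = `|c| * cochain_norm f.
Proof.
move=> Cf; apply: le_anti; rewrite cochain_norm_leZ//=.
have [->|c0] := eqVneq c 0; first by rewrite normr0 mul0r cochain_norm_ge0.
have nc0 : 0 < `|c| by rewrite normr_gt0.
rewrite -ler_pdivlMl// -normfV -[X in cochain_norm X](scalerK c0).
by apply: cochain_norm_leZ; exact: cochainZ.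
Qed.

Let cochain_norm_eq0 f : C f -> cochain_norm f = 0 -> f = 0.
Proof.
move=> Cf f0; apply/funext => t; apply/normr0_eq0/eqP.
by rewrite eq_le normr_ge0 andbT -f0 cochain_norm_pt.
Qed.

Let cochain_complete (u : nat -> k.+1.-tuple V -> E) :
  (forall i, C (u i)) -> norm_cauchy cochain_norm u ->
  exists2 l, C l & norm_cvg cochain_norm u l.
Proof.
move=> Cu uC.
have /choice[l ul] t : exists l, norm_cvg Num.norm (u ^~ t) l.
  apply: norm_cauchy_cvg => e /uC[m um]; exists m => i j mi mj.
  apply: le_trans (um i j mi mj).
  exact: (@cochain_norm_pt (u i - u j) t (cochainB (Cu i) (Cu j))).
have l0 t : ~ ordered_simplex X t -> l t = 0.
  move=> nOt; apply: norm_cvg_unique (ul t) _ => e e0; exists 0%N => i _.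
  by have [->] := Cu i => //; rewrite subrr normr0 ltW.
have l_alt t (s : 'S_k.+1) : ordered_simplex X t ->
    l [tuple tnth t (s i) | i < k.+1] = (-1) ^+ s *: l t.
  move=> Ot; apply: norm_cvg_unique (ul _) _.
  rewrite (_ : u ^~ _ = fun i => (-1) ^+ s *: u i t); first exact: norm_cvgZ.
  by apply/funext => i; have [_ ->] := Cu i.
have l_inv t : ordered_simplex X t ->
    l t = l (act_tuple a (dom_elt a F (vertices t))^-1%g t).
  move=> Ot; apply: norm_cvg_unique (ul _) _.
  rewrite (_ : u ^~ _ = u ^~ (act_tuple a (dom_elt a F (vertices t))^-1%g t)) //.
  by apply/funext => i; have [_ _ ui _] := Cu i; rewrite -ui.
(* The bound on [u i - u j] passes to the limit in [j] by lower semicontinuity. *)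
have tail e : 0 < e -> exists m, forall i, (m <= i)%N ->
    (lpnorm F p (u i - l)%R <= e%:E)%E.
  move=> e0; have [m um] := uC e e0; exists m => i mi.
  apply: (@lpnorm_on_lim _ _ p_ge1 _ _ _ (fun j => u i - u j) _ _ m).
  - exact: ltW.
  - move=> t _ d d0; have [m' h] := ul t d d0; exists m' => j mj.
    by rewrite !fctE opprB addrCA addrAC subrr add0r distrC h.
  - by move=> j mj; rewrite -lpnormE -cochain_norm_le ?um//; exact: cochainB.
(* Finiteness of the norm is the only cochain condition in doubt for [u i - l], and [tail] secures
   it for large [i]. *)
have Cul i : C (u i - l) \/ (lpnorm F p (u i - l)%R = +oo)%E.
  have [h|h] := pselect (lpnorm F p (u i - l)%R < +oo)%E; last first.
    by right; apply/eqP; rewrite -leye_eq leNgt; apply/negP.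
  left; have [u0 u_alt u_inv _] := Cu i; split=> // [t nOt|t s Ot|t Ot].
  - by rewrite !fctE u0// l0// subr0.
  - by rewrite !fctE u_alt// l_alt// scalerBr.
  - by rewrite !fctE [in LHS]u_inv// [in LHS]l_inv.
have {}Cul e : 0 < e -> exists m, forall i, (m <= i)%N ->
    C (u i - l) /\ cochain_norm (u i - l) <= e.
  move=> e0; have [m um] := tail e e0; exists m => i mi.
  have [h|h] := Cul i; last by have := um i mi; rewrite h leye_eq.
  by split=> //; rewrite cochain_norm_le// um.
exists l; last first.
  by move=> e /Cul[m um]; exists m => i /um[].
(* The limit [l] is the difference of the cochains [u m] and [u m - l]. *)
have [m /(_ m (leqnn _))[Cm _]] := Cul 1 ltr01.
by rewrite -[l](subKr (u m)); exact: cochainB.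
Qed.

Definition cochain_banach : banach_subspace (k.+1.-tuple V -> E) :=
  BanachSubspace cochain0 cochainP cochain_normD cochain_normZ
    cochain_norm_eq0 cochain_complete.

End CochainBanach.

(** * The codifferential *)

(** The pairs with [i <= j] are matched with the others by sending [(i, j)] to [(j + 1, i)], and
    matched terms cancel. [H] takes natural numbers so that an index can move between the two
    ranges. *)
Lemma alternating_double_sum (M : zmodType) n (H : nat -> nat -> M) :
  (forall i j, (i <= j < n)%N -> H i j = - H j.+1 i) ->
  \sum_(i < n.+1) \sum_(j < n) H i j = 0.
Proof.
move=> Hij.
have -> : \sum_(i < n.+1) \sum_(j < n) H i j =
    \sum_(i < n.+1) \sum_(j < n | (i <= j)%N) H i j +
    \sum_(i < n.+1) \sum_(j < n | ~~ (i <= j)%N) H i j.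
  by rewrite -big_split; apply: eq_bigr => i _; exact: bigID.
(* The row [i = n] of the first half and the row [i = 0] of the second are empty; without them both
   halves have [n] rows, the second with its outer index shifted by one. *)
rewrite big_ord_recr /= [X in _ + X + _]big_pred0 ?addr0; last first.
  by move=> j; rewrite leqNgt ltn_ord.
rewrite [X in _ + X]big_ord_recl /= [X in _ + (X + _)]big_pred0 ?add0r//.
under [X in _ + X]eq_bigr do under eq_bigl do rewrite -ltnNge ltnS.
rewrite [X in _ + X](exchange_big_dep xpredT)//= -big_split big1// => i _ /=.
by rewrite -big_split big1// => j ij /=; rewrite Hij ?ij ?ltn_ord// addNr.
Qed.

Section Codifferential.
Variables (R : realType) (G : groupType) (V : choiceType).
Variables (X : simplicial_complex V) (a : simplicial_action G X).
Variables (F : set {fset V}).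
Variable E : completeNormedModType R.
Implicit Types pi : representation G E.

Lemma rep_sub pi g x y : pi g (x - y) = pi g x - pi g y.
Proof. exact: (lin_sub (rep_linear pi g)). Qed.

Lemma rep0 pi g : pi g 0 = 0.
Proof. exact: (lin0 (rep_linear pi g)). Qed.

Lemma rep_sum pi g (I : Type) (r : seq I) (P : pred I) (f : I -> E) :
  pi g (\sum_(i <- r | P i) f i) = \sum_(i <- r | P i) pi g (f i).
Proof.
by apply: (big_morph (pi g)); [exact: (lin_add (rep_linear pi g))|exact: rep0].
Qed.

Lemma repZ pi g (c : R) x : pi g (c *: x) = c *: pi g x.
Proof. exact: (lin_scale (rep_linear pi g)). Qed.

Lemma codiff_linear pi k : linear (@codiff R G V X a F E pi k).
Proof.
move=> c f g; apply/funext => t; rewrite /codiff !fctE.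
case: asboolP => _; last by rewrite scaler0 addr0.
rewrite scaler_sumr -big_split; apply: eq_bigr => i _ /=.
by rewrite !rep_linear scalerDr !scalerA mulrC.
Qed.

Lemma face_ordered k (t : k.+2.-tuple V) (i : 'I_k.+2) :
  ordered_simplex X t -> ordered_simplex X (face t i).
Proof.
move=> [ut Xt]; split.
  apply/tuple_uniqP => x y; rewrite !tnth_mktuple.
  by move=> /(tuple_uniqP _ ut) /lift_inj.
apply: simplices_face Xt _ _.
  apply/fsubsetP => v; rewrite !inE => /tnthP[j ->].
  by rewrite tnth_mktuple mem_tnth.
apply/fset0Pn; exists (tnth (face t i) ord0).
by rewrite !inE mem_tnth.
Qed.

Lemma face_face k (t : k.+3.-tuple V) (i j : nat) : (i <= j < k.+2)%N ->
  face (face t (inord i)) (inord j) = face (face t (inord j.+1)) (inord i).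
Proof.
move=> /andP[ij jk]; apply: eq_from_tnth => x; rewrite !tnth_mktuple.
congr tnth; apply: val_inj => /=.
rewrite !inordK ?ltnS//; [|lia..].
by rewrite /bump; lia.
Qed.

(** On each face the outer factor [pi g] cancels the inner factor [pi g^-1], leaving the ordinary
    double alternating sum of [phi], which vanishes by the simplicial identity [face_face]. *)
Lemma codiff_codiff pi k (f : k.+1.-tuple V -> E) :
  codiff a F pi (codiff a F pi f) = 0.
Proof.
apply/funext => t; rewrite /codiff; case: asboolP => // Ot.
pose phi (u : k.+1.-tuple V) := pi (dom_elt a F (vertices u)) (f u).
pose H i j := (-1) ^+ (i + j) *: pi (dom_elt a F (vertices t))^-1%g
  (phi (face (face t (inord i)) (inord j))).
apply: etrans (@alternating_double_sum _ k.+2 H _); last first.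
  move=> i j ij; rewrite /H face_face// addSn exprS mulN1r scaleNr opprK.
  by rewrite addnC.
apply: eq_bigr => i _; rewrite asboolT; last exact: face_ordered.
rewrite !rep_sum scaler_sumr; apply: eq_bigr => j _.
rewrite !repZ scalerA -exprD /H !inord_val; congr (_ *: pi _ _).
by rewrite -repM mulgV rep1.
Qed.

End Codifferential.

(** * Deformations *)

Section Deformations.
Variables (R : realType) (G : groupType) (S : seq G).
Variable E : completeNormedModType R.
Implicit Types pi rho : representation G E.

Lemma rep_bound pi g : exists2 M, 0 <= M & forall x, `|pi g x| <= M * `|x|.
Proof.
have [M piM] := rep_bounded pi g; exists `|M| => // x.
by rewrite (le_trans (piM x))// ler_wpM2r// ler_norm.
Qed.

Lemma deformation_le eps pi rho s x : deformation S eps pi rho -> s \in S ->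
  `|pi s x - rho s x| <= eps * `|x|.
Proof.
move=> def sS; set T := fun x => pi s x - rho s x.
have opT : opnorm T <= eps.
  pose f s0 := opnorm (fun x0 => pi s0 x0 - rho s0 x0).
  exact: le_trans (@le_bigmax_seq _ _ _ S 0 s xpredT f sS isT) def.
have [M _ piM] := rep_bound pi s; have [N _ rhoN] := rep_bound rho s.
have [->|x0] := eqVneq x 0; first by rewrite !rep0 subrr normr0 mulr0.
have nx0 : 0 < `|x| by rewrite normr_gt0.
rewrite -ler_pdivrMr//; apply: le_trans opT.
have -> : `|T x| / `|x| = `|T (`|x|^-1 *: x)|.
  by rewrite /T !repZ -scalerBr normrZ normfV normr_id mulrC.
apply: ub_le_sup; last by exists (`|x|^-1 *: x) => //=; rewrite normfZV.
exists (`|M| + `|N|) => _ [y /= y1 <-].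
rewrite (le_trans (ler_normB _ _))// lerD//.
  rewrite (le_trans (piM y))// -[leRHS]mulr1.
  by rewrite (le_trans (ler_wpM2r _ (ler_norm M)))// ler_wpM2l.
rewrite (le_trans (rhoN y))// -[leRHS]mulr1.
by rewrite (le_trans (ler_wpM2r _ (ler_norm N)))// ler_wpM2l.
Qed.

(** The elements [g] admitting such bounds are stable under products, so generators and their
    inverses are enough. [M] may depend on [g] but not on [rho], which keeps a simultaneous sum over
    all deformations bounded. *)
Lemma near_representations_bounded pi : generating S ->
  exists2 eps0, 0 < eps0 &
    forall g, exists2 M, 0 <= M & forall rho eps,
      0 < eps -> eps <= eps0 -> deformation S eps pi rho ->
      (forall x, `|rho g x| <= M * `|x|) /\
      (forall x, `|rho g x - pi g x| <= M * eps * `|x|).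
Proof.
move=> S_gen.
have [K K0 piK] : exists2 K, 0 < K &
    forall s, s \in S -> forall x, `|pi s^-1%g x| <= K * `|x|.
  elim: S {S_gen} => [|s s' [K K0 IH]]; first by exists 1.
  have [M M0 piM] := rep_bound pi s^-1%g.
  exists (K + M) => [|s1]; first by rewrite ltr_pwDl.
  rewrite inE => /predU1P[->|/IH h] x.
    by rewrite (le_trans (piM x))// ler_wpM2r// lerDr ltW.
  by rewrite (le_trans (h x))// ler_wpM2r// lerDl.
(* At this size, in [y = pi s^-1 (pi s y)] the replacement of [pi s] by [rho s] costs at most half
   the norm of [y]; absorbing it bounds [rho s^-1] by [2 * K]. *)
pose e0 := (2 * K)^-1; have e0_gt0 : 0 < e0 by rewrite invr_gt0 mulr_gt0.
exists e0 => //.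
pose P g := exists2 M, 0 <= M & forall rho eps,
  0 < eps -> eps <= e0 -> deformation S eps pi rho ->
  (forall x, `|rho g x| <= M * `|x|) /\
  (forall x, `|rho g x - pi g x| <= M * eps * `|x|).
have PM g h : P g -> P h -> P (g * h)%g.
  move=> [Mg Mg0 Pg] [Mh Mh0 Ph]; have [N N0 piN] := rep_bound pi h.
  exists (Mg * Mh + Mg * N) => [|rho eps eps_gt0 ee def].
    by rewrite addr_ge0// mulr_ge0.
  have [rg dg] := Pg rho eps eps_gt0 ee def.
  have [rh dh] := Ph rho eps eps_gt0 ee def.
  split=> x; rewrite !repM.
    rewrite (le_trans (rg _))// (le_trans (ler_wpM2l Mg0 (rh x)))// mulrA.
    by rewrite ler_wpM2r// lerDl mulr_ge0.
  have -> : rho g (rho h x) - pi g (pi h x) =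
      rho g (rho h x - pi h x) + (rho g (pi h x) - pi g (pi h x)).
    by rewrite rep_sub addrA subrK.
  rewrite (le_trans (ler_normD _ _))// !mulrDl lerD//.
    by rewrite (le_trans (rg _))// -!mulrA ler_wpM2l// mulrA.
  apply: le_trans (dg _) _; rewrite -!mulrA ler_wpM2l// [leRHS]mulrCA.
  by rewrite ler_wpM2l ?piN// ltW.
have Pgen s : s \in S -> P s /\ P s^-1%g.
  move=> sS; have [N N0 piN] := rep_bound pi s.
  have bnd rho eps x : eps <= e0 -> deformation S eps pi rho ->
      `|rho s^-1%g x| <= 2 * K * `|x|.
    move=> ee def; set y := rho _ _.
    have xE : rho s y = x by rewrite /y -repM mulgV rep1.
    have : `|y| <= K * `|x| + 2^-1 * `|y|.
      have {1}-> : y = pi s^-1%g (pi s y) by rewrite -repM mulVg rep1.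
      apply: le_trans (piK s sS _) _.
      have -> : pi s y = x + (pi s y - rho s y) by rewrite xE subrKC.
      apply: le_trans (ler_wpM2l (ltW K0) (ler_normD _ _)) _.
      rewrite mulrDr lerD2l.
      apply: le_trans (ler_wpM2l (ltW K0) (deformation_le y def sS)) _.
      rewrite mulrA ler_wpM2r// mulrC -ler_pdivlMr//.
      by rewrite (le_trans ee)// /e0 invfM.
    lra.
  split.
    exists (N + e0 + 1) => [|rho eps eps_gt0 ee def].
      by rewrite !addr_ge0// ltW.
    have dle x : `|rho s x - pi s x| <= eps * `|x|.
      by rewrite distrC deformation_le.
    split=> x.
      rewrite -[rho s x](subrK (pi s x)) (le_trans (ler_normD _ _))// addrC.
      rewrite (le_trans (lerD (piN x) (dle x)))// -mulrDl ler_wpM2r//.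
      by rewrite -addrA lerD2l (le_trans ee)// lerDl.
    rewrite (le_trans (dle x))// ler_wpM2r//.
    rewrite -{1}[eps]mul1r ler_wpM2r// ?(ltW eps_gt0)//.
    by rewrite lerDr addr_ge0// ltW.
  exists (2 * K + 2 * K * K) => [|rho eps eps_gt0 ee def].
    by rewrite addr_ge0 ?mulr_ge0// ltW.
  split=> x.
    rewrite (le_trans (bnd rho eps x ee def))// ler_wpM2r// lerDl.
    by rewrite !mulr_ge0// ltW.
  set y := pi s^-1%g x.
  (* This is the resolvent identity [rho s^-1 - pi s^-1 = rho s^-1 (pi s - rho s) pi s^-1]. *)
  have -> : rho s^-1%g x - y = rho s^-1%g (pi s y - rho s y).
    by rewrite rep_sub -!repM mulgV mulVg !rep1.
  rewrite (le_trans (bnd rho eps _ ee def))//.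
  have K2 : 0 <= 2 * K by rewrite mulr_ge0// ltW.
  apply: le_trans (ler_wpM2l K2 (deformation_le y def sS)) _.
  apply: (@le_trans _ _ (2 * K * (eps * (K * `|x|)))).
    by rewrite ler_wpM2l// ler_wpM2l ?piK// ltW.
  rewrite mulrA mulrA [2 * K * eps * K]mulrAC ler_wpM2r//.
  rewrite ler_wpM2r ?(ltW eps_gt0)//.
  by rewrite lerDr.
(* Pairing [g] with its inverse makes [Q] symmetric by construction, as a subgroup requires. *)
pose Q : set G := [set g | P g /\ P g^-1%g].
have QT : Q = setT.
  apply: S_gen.
  - have P1 : P 1%g.
      exists 1 => // rho eps eps_gt0 _ _; split=> x; rewrite !rep1 ?mul1r//.
      by rewrite subrr normr0 mulr_ge0// ltW.
    by split=> //; rewrite invg1.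
  - by move=> g h [Pg Pg'] [Ph Ph']; split; rewrite ?invMg; exact: PM.
  - by move=> g [Pg Pg']; split; rewrite ?invgK.
  - by move=> s /Pgen.
by move=> g; have [] : Q g by rewrite QT.
Qed.

End Deformations.

(** * One block representation for all small deformations *)

Section BlockRepresentation.
Variables (R : realType) (G : groupType) (S : seq G).
Variables (E : completeNormedModType R) (pi : representation G E) (eps0 : R).
Hypothesis near_bounded :
  forall g, exists2 M, 0 <= M & forall (rho : representation G E) eps,
    0 < eps -> eps <= eps0 -> deformation S eps pi rho ->
    (forall x, `|rho g x| <= M * `|x|) /\
    (forall x, `|rho g x - pi g x| <= M * eps * `|x|).

(** Each deformation is indexed together with an admissible [eps], by which its off-diagonal block
    is divided. The boolean in [I] below selects the component of [E^2], [true] being the first. *)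
Let J := {d : representation G E * R |
  [/\ 0 < d.2, d.2 <= eps0 & deformation S d.2 pi d.1]}.

Let rho_ (j : J) : representation G E := (sval j).1.
Let eps_ (j : J) : R := (sval j).2.

Let eps_gt0 j : 0 < eps_ j. Proof. by case: (svalP j). Qed.

Let I : Type := (J * bool)%type.
Let L : completeNormedModType R := bs_type (linfty I E).

(* Conjugating diag(pi, rho) by [[1, 1/eps], [0, 1]] gives the block matrix
   [[pi, (rho - pi)/eps], [0, rho]], which is bounded uniformly in rho. *)
Definition block_fun (g : G) (x : I -> E) : I -> E := fun i =>
  if i.2 then pi g (x (i.1, true)) +
    (eps_ i.1)^-1 *: (rho_ i.1 g (x (i.1, false)) - pi g (x (i.1, false)))
  else rho_ i.1 g (x (i.1, false)).

(** The factor [eps^-1] of the off-diagonal block is compensated by the bound on [rho g - pi g],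
    which is linear in [eps]. *)
Lemma block_fun_bound g : exists2 M, 0 <= M &
  forall x, bounded_funs x -> forall i, `|block_fun g x i| <= M * supnorm x.
Proof.
have [M M0 MP] := near_bounded g; have [N N0 piN] := rep_bound pi g.
exists (N + M) => [|x bx [j b]]; first exact: addr_ge0.
have [e0 ee def] := svalP j; have [rb db] := MP _ _ e0 ee def.
rewrite /block_fun /=; case: b => /=; last first.
  apply: le_trans (rb _) (le_trans (ler_wpM2l M0 (supnorm_ge (j, false) bx)) _).
  by rewrite ler_wpM2r ?supnorm_ge0// lerDr.
rewrite (le_trans (ler_normD _ _))// mulrDl lerD//.
  by rewrite (le_trans (piN _))// ler_wpM2l// supnorm_ge.
rewrite normrZ gtr0_norm ?invr_gt0// ler_pdivrMl//.
apply: le_trans (db _) _; rewrite mulrA [eps_ j * M]mulrC.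
by rewrite ler_wpM2l ?supnorm_ge// mulr_ge0// ltW.
Qed.

Let block_bounded g (x : L) : bounded_funs (block_fun g (bs_val x)).
Proof.
have [M _ MP] := block_fun_bound g.
by exists (M * supnorm (bs_val x)) => i; apply: MP; exact: bs_valP x.
Qed.

Let block g (x : L) : L := bs_mk (B := linfty I E) (block_bounded g x).

Let block_linear g (c : R) x y :
  block g (c *: x + y) = c *: block g x + block g y.
Proof.
apply/val_inj/funext => i.
rewrite [RHS](_ : _ = c *: block_fun g (bs_val x) i + block_fun g (bs_val y) i)//.
rewrite [LHS](_ : _ = block_fun g (fun j => c *: bs_val x j + bs_val y j) i)//.
rewrite /block_fun !rep_linear; case: i.2 => //.
rewrite opprD [in LHS]addrACA -scalerBr [_ *: (_ + _)]scalerDr.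
by rewrite scalerA [_^-1 * c]mulrC -scalerA addrACA -scalerDr.
Qed.

Let block_bound g : exists M : R, forall x, `|block g x| <= M * `|x|.
Proof.
have [M M0 MP] := block_fun_bound g; exists M => x.
rewrite !bs_normE /=; apply: supnorm_le => [|i].
  by rewrite mulr_ge0// supnorm_ge0.
by apply: MP; exact: bs_valP x.
Qed.

Let block1 x : block 1%g x = x.
Proof.
apply/val_inj/funext => -[j b] /=; rewrite /block_fun /= !rep1.
by case: b => //=; rewrite subrr scaler0 addr0.
Qed.

(** The off-diagonal entries compose because [pi g (rho h - pi h) + (rho g - pi g) rho h = rho (g h)
    - pi (g h)]. *)
Let blockM g h x : block (g * h)%g x = block g (block h x).
Proof.
apply/val_inj/funext => -[j b] /=; rewrite /block_fun /= !repM.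
case: b => //=; rewrite (lin_add (rep_linear pi g)) repZ -addrA; congr (_ + _).
by rewrite -scalerDr rep_sub; congr (_ *: _); rewrite [RHS]addrC addrA subrK.
Qed.

Definition block_rep : representation G L :=
  Representation block_linear block_bound block1 blockM.

(** The vector is placed in the second component at every index, so that the first component of its
    image under the block of [g] is [(rho g x - pi g x) / eps]. *)
Let embed_fun (x : E) : I -> E := fun i => if i.2 then 0 else x.

Let embed_bounded x : bounded_funs (embed_fun x).
Proof. by exists `|x| => -[j []] /=; rewrite ?normr0. Qed.

Definition block_embed (x : E) : L := bs_mk (B := linfty I E) (embed_bounded x).

Lemma block_embed_linear : linear block_embed.
Proof.
move=> c x y; apply/val_inj/funext => -[j b] /=.
rewrite [RHS](_ : _ = c *: embed_fun x (j, b) + embed_fun y (j, b))//.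
by rewrite /embed_fun; case: b => //=; rewrite scaler0 addr0.
Qed.

Lemma block_embed_le x : `|block_embed x| <= `|x|.
Proof.
rewrite bs_normE; apply: supnorm_le => // -[j []] //=.
by rewrite /embed_fun /= normr0.
Qed.

(** The sums have the shape of a codifferential at one simplex. At the index [(rho, eps)], the first
    component of the block sum is their difference divided by [eps], and the sup norm dominates
    it. *)
Lemma block_sum_le (n : nat) (c : 'I_n -> R) (g h : 'I_n -> G) (y : 'I_n -> E)
    (rho : representation G E) (eps : R) :
  0 < eps -> eps <= eps0 -> deformation S eps pi rho ->
  `|\sum_(i < n) c i *: rho (g i) (rho (h i) (y i)) -
    \sum_(i < n) c i *: pi (g i) (pi (h i) (y i))| <=
  eps * `|\sum_(i < n)
    c i *: block_rep (g i) (block_rep (h i) (block_embed (y i)))|.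
Proof.
move=> e0 ee def; pose j : J := exist _ (rho, eps) (And3 e0 ee def).
set z := \sum_(i < n) c i *: block_rep _ _.
pose ev (x : L) : E := bs_val x (j, true).
have evD : {morph ev : x y / x + y >-> x + y} by [].
have zE : ev z = eps^-1 *: (\sum_(i < n) c i *: rho (g i) (rho (h i) (y i)) -
    \sum_(i < n) c i *: pi (g i) (pi (h i) (y i))).
  rewrite /z (big_morph ev evD (erefl : ev 0 = 0)) -sumrB scaler_sumr.
  apply: eq_bigr => i _; rewrite -!repM.
  have -> : ev (c i *: block_rep (g i * h i)%g (block_embed (y i))) =
      c i *: ev (block_rep (g i * h i)%g (block_embed (y i))) by [].
  rewrite /ev /= /block_fun /= /embed_fun /= rep0 add0r.
  by rewrite -scalerBr !scalerA mulrC.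
rewrite -ler_pdivrMl// -[eps^-1]gtr0_norm ?invr_gt0// -normrZ -zE.
by rewrite bs_normE; exact: supnorm_ge (bs_valP z).
Qed.

End BlockRepresentation.

(** * Cohomology of deformations *)

Section CochainMaps.
Variables (R : realType) (G : groupType) (V : choiceType).
Variables (X : simplicial_complex V) (a : simplicial_action G X).
Variables (F : set {fset V}) (F_dom : fundamental_domain a F).
Variables (p : R) (p_ge1 : 1 <= p) (d_bounded : codifferentials_bounded a F p).

Lemma cochain_comp (E L : completeNormedModType R) (i : E -> L) k
    (f : k.+1.-tuple V -> E) :
  linear i -> (forall x, `|i x| <= `|x|) -> cochain a F p f ->
  cochain a F p (i \o f) /\ (lpnorm F p (i \o f) <= lpnorm F p f)%E.
Proof.
move=> lin_i i_le [f0 f_alt f_inv f_fin].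
have le_f : (lpnorm F p (i \o f) <= lpnorm F p f)%E.
  by apply: le_lpnorm_on => // t _; exact: i_le.
split=> //; split=> [t nOt|t s Ot|t Ot|].
- by rewrite /= f0// (lin0 lin_i).
- by rewrite /= f_alt// (lin_scale lin_i).
- by rewrite /= -f_inv.
- exact: le_lt_trans f_fin.
Qed.

Lemma codiff_cochain (E : completeNormedModType R) (pi : representation G E) k
    (f : k.+1.-tuple V -> E) :
  cochain a F p f -> cochain a F p (codiff a F pi f).
Proof. by have [M dM] := d_bounded pi k => /dM[]. Qed.

(** The constant bounds the codifferential of the block representation, hence is independent of
    [rho]; [block_sum_le], applied simplex by simplex to the embedded cochain, supplies the factor
    [eps]. *)
Lemma codiff_deformation (S : seq G) (E : completeNormedModType R)
    (pi : representation G E) : generating S ->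
  exists2 eps0, 0 < eps0 & forall k, exists2 M, 0 <= M &
    forall (rho : representation G E) eps,
      0 < eps -> eps <= eps0 -> deformation S eps pi rho ->
      forall f : k.+1.-tuple V -> E, cochain a F p f ->
        (lpnorm F p (codiff a F rho f - codiff a F pi f)%R <=
         (eps * M * cochain_norm F p f)%:E)%E.
Proof.
move=> /(near_representations_bounded pi)[eps0 eps0_gt0 nb].
exists eps0 => // k; have [M dM] := d_bounded (block_rep nb) k.
exists `|M| => // rho eps e0 ee def f Cf.
have [Cif if_le] := cochain_comp (block_embed_linear S pi eps0)
  (@block_embed_le _ _ S _ pi eps0) Cf.
have [Cdif dif_le] := dM _ Cif.
set dif := codiff a F (block_rep nb) _ in Cdif dif_le.
have pt t : `|(codiff a F rho f - codiff a F pi f) t| <= `|(eps *: dif) t|.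
  rewrite !fctE /dif /codiff; case: asboolP => _; last first.
    by rewrite subr0 scaler0 !normr0.
  by rewrite normrZ gtr0_norm// block_sum_le.
apply: (@le_trans _ _ (lpnorm F p (eps *: dif)%R)).
  by apply: le_lpnorm_on => // t _; exact: pt.
rewrite -mulrA -[X in (X * _)%R]gtr0_norm//.
apply: lpnorm_onZ => //; first by rewrite mulr_ge0// cochain_norm_ge0.
apply: le_trans dif_le _; rewrite EFinM -(cochain_normE Cf).
apply: (@le_trans _ _ (`|M|%:E * lpnorm F p (block_embed S pi eps0 \o f)))%E.
  by rewrite lee_wpmul2r ?poweR_ge0// lee_fin ler_norm.
by rewrite lee_wpmul2l.
Qed.

Variable E : completeNormedModType R.
Implicit Types pi : representation G E.

Let C k : completeNormedModType R :=
  bs_type (cochain_banach F_dom p_ge1 E k).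

Let lpnormC k (x : C k) : lpnorm F p (bs_val x) = `|x|%:E.
Proof. exact: cochain_normE (bs_valP x). Qed.

Definition cochain_map pi k (x : C k) : C k.+1 :=
  bs_mk (B := cochain_banach F_dom p_ge1 E k.+1)
    (codiff_cochain pi (bs_valP x)).

Lemma cochain_map_linear pi k : linear (@cochain_map pi k).
Proof. by move=> c x y; apply: val_inj; exact: codiff_linear. Qed.

Lemma cochain_map_bound pi k :
  exists M, forall x, `|@cochain_map pi k x| <= M * `|x|.
Proof.
have [M dM] := d_bounded pi k; exists M => x.
have [_] := dM _ (bs_valP x).
by rewrite -[codiff _ _ _ _]/(bs_val (cochain_map pi x)) !lpnormC -EFinM lee_fin.
Qed.

Lemma cochain_map_eq0 pi k (x : C k) :
  cochain_map pi x = 0 <-> cocycles a F p pi (bs_val x).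
Proof.
split=> [x0|[_ x0]]; last exact: val_inj.
by split; [exact: bs_valP x|exact: (congr1 (@bs_val _ _ _) x0)].
Qed.

Lemma range_cochain_map pi k (y : C k.+1) :
  range (@cochain_map pi k) y <-> coboundaries a F p pi (bs_val y).
Proof.
split=> [[x _ <-]|[f Cf fy]]; first by exists (bs_val x) => //; exact: bs_valP x.
exists (bs_mk (B := cochain_banach F_dom p_ge1 E k) Cf) => //.
exact: val_inj.
Qed.

Lemma reduced_closed_range pi k : cohomology_reduced a F p pi k.+1 ->
  forall y, (forall e, 0 < e -> exists x, `|y - @cochain_map pi k x| <= e) ->
    range (@cochain_map pi k) y.
Proof.
move=> red y yP; apply/range_cochain_map; rewrite -red; split.
  exact: bs_valP y.
(* Halving [e] turns the non-strict approximation into the strict one that [lp_closure] asks for. *)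
move=> e e0; have [x xe] := yP (e / 2) (divr_gt0 e0 (ltr0Sn R 1)).
exists (bs_val (cochain_map pi x)); first by apply/range_cochain_map; exists x.
have -> : lpnorm F p (bs_val y \- bs_val (cochain_map pi x))%R =
    `|y - cochain_map pi x|%:E by rewrite -lpnormC.
by rewrite lte_fin (le_lt_trans xe)// gtr_pMr// invf_lt1// ltr1n.
Qed.

Lemma cochain_map_deformation (S : seq G) pi : generating S ->
  forall k eta, 0 < eta -> exists2 eps1, 0 < eps1 &
    forall rho eps, 0 < eps -> eps <= eps1 -> deformation S eps pi rho ->
      forall x : C k, `|cochain_map pi x - cochain_map rho x| <= eta * `|x|.
Proof.
move=> /(codiff_deformation pi)[eps0 eps0_gt0 def_le] k eta eta0.
have [M M0 MP] := def_le k.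
have M1 : 0 < M + 1 by rewrite ltr_wpDl.
exists (Num.min eps0 (eta / (M + 1))) => [|rho eps e0].
  by rewrite lt_min eps0_gt0 divr_gt0.
rewrite le_min => /andP[ee0 ee1] def x.
rewrite distrC -lee_fin -lpnormC.
apply: le_trans (MP rho eps e0 ee0 def _ (bs_valP x)) _.
rewrite lee_fin -[cochain_norm _ _ _]/(`|x|) ler_wpM2r//.
rewrite (le_trans (ler_wpM2r M0 ee1))// -mulrA ger_pMr// mulrC.
by rewrite ler_pdivrMr// mul1r lerDl.
Qed.

Lemma coboundaries_sub_cocycles pi k :
  coboundaries a F p pi (k := k) `<=` cocycles a F p pi (k := k).
Proof.
case: k => [_ ->|k _ [f Cf <-]].
  split; first exact: bs_carrier0 (cochain_banach F_dom p_ge1 E 0).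
  exact: (lin0 (@codiff_linear R G V X a F E pi 0)).
by split; [exact: codiff_cochain|exact: codiff_codiff].
Qed.

End CochainMaps.

Theorem theorem2 (R : realType) (G : groupType) (S : seq G)
    (S_gen : generating S)
    (V : choiceType) (X : simplicial_complex V)
    (X_ulf : uniformly_locally_finite X)
    (a : simplicial_action G X) (a_free : free_action a)
    (F : set {fset V}) (F_dom : fundamental_domain a F)
    (p : R) (p_ge1 : 1 <= p)
    (d_bounded : codifferentials_bounded a F p)
    (E : completeNormedModType R) (pi : representation G E) (n : nat)
    (H1 : cohomology_zero a F p pi n)
    (H2 : cohomology_reduced a F p pi n.+1) :
  exists eps : R, 0 < eps /\
    forall rho : representation G E,
      deformation S eps pi rho -> cohomology_zero a F p rho n.

Proof.
(* Coboundaries are cocycles for every representation; only the converse inclusion depends on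
   closeness to [pi]. *)
suff [eps1 e1 stable] : exists2 eps1, 0 < eps1 &
    forall rho : representation G E, deformation S eps1 pi rho ->
    cocycles a F p rho (k := n) `<=` coboundaries a F p rho (k := n).
  exists eps1; split=> // rho def; apply/seteqP; split; first exact: stable.
  exact: (coboundaries_sub_cocycles F_dom p_ge1 d_bounded).
pose C k : completeNormedModType R := bs_type (cochain_banach F_dom p_ge1 E k).
pose D (tau : representation G E) k : C k -> C k.+1 :=
  cochain_map d_bounded tau (k := k).
have linD tau k : linear (@D tau k).
  exact: cochain_map_linear.
have clD := reduced_closed_range (F_dom := F_dom) (p_ge1 := p_ge1)
  (d_bounded := d_bounded) H2.
have [M1 b1] := cochain_map_bound F_dom p_ge1 d_bounded pi n.
have close := cochain_map_deformation F_dom p_ge1 d_bounded pi S_gen.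
case: n H1 H2 clD M1 b1 => [|k] H1' _ clD M1 b1.
  (* In degree 0 only the zero cochain is a coboundary, so the zero map [Z] stands in for the
     preceding codifferential of both [pi] and [rho]. *)
  pose Z : C 0%N -> C 0%N := fun=> 0.
  have ker0 b : D pi 0%N b = 0 <-> range Z b.
    split=> [/cochain_map_eq0|[x _ <-]]; last exact: (lin0 (linD pi 0%N)).
    by rewrite H1' => b0; exists 0 => //; apply: val_inj; exact: esym.
  have linZ : linear Z by move=> c x y; rewrite /Z scaler0 addr0.
  have bZ x : `|Z x| <= 0 * `|x| by rewrite /Z normr0 mul0r.
  have [eta eta0 stable] := exactness_stable linZ bZ (linD pi _) b1 ker0 clD.
  have [eps1 e1 close1] := close 0%N eta eta0.
  exists eps1 => // rho def f [Cf f0].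
  pose b : C 0%N := bs_mk (B := cochain_banach F_dom p_ge1 E 0) Cf.
  have [|||| x _ xb] := stable Z (D rho 0%N) linZ (linD rho 0%N) _ _ _ b.
  - by move=> x; rewrite subrr normr0 mulr_ge0// ltW.
  - by move=> x; exact: close1 e1 (lexx _) def x.
  - by move=> x; exact: (lin0 (linD rho 0%N)).
  - exact: val_inj.
  by rewrite -[f]/(bs_val b) -xb.
have [M0 b0] := cochain_map_bound F_dom p_ge1 d_bounded pi k.
have ker_range b : D pi k.+1 b = 0 <-> range (D pi k) b.
  rewrite /D; split.
    by move=> /cochain_map_eq0; rewrite H1' => /range_cochain_map.
  by move=> /range_cochain_map; rewrite -H1' => /cochain_map_eq0.
have [eta eta0 stable] :=
  exactness_stable (linD pi _) b0 (linD pi _) b1 ker_range clD.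
have [eps0 e0 close0] := close k eta eta0.
have [eps1 e1 close1] := close k.+1 eta eta0.
have m0 : 0 < Num.min eps0 eps1 by rewrite lt_min e0.
exists (Num.min eps0 eps1) => // rho def f [Cf f0].
have [le0 le1] : Num.min eps0 eps1 <= eps0 /\ Num.min eps0 eps1 <= eps1.
  by rewrite !ge_min !lexx orbT.
pose b : C k.+1 := bs_mk (B := cochain_banach F_dom p_ge1 E k.+1) Cf.
rewrite -[f]/(bs_val b); apply/range_cochain_map.
apply: (stable (D rho k) (D rho k.+1)) => //.
- by move=> x; exact: close0 m0 le0 def x.
- by move=> x; exact: close1 m0 le1 def x.
- by move=> x; apply: val_inj; exact: codiff_codiff.
- exact: val_inj.
Qed.
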